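(* Let $1\le r\le p$, $Y\in\mathbb{R}^{p\times r}_*$, $X=YY^\top$, let $U\in\mathrm{St}(r,p)$ span the top $r$ eigenspace (i.e. the column space) of $X$, and $P=U^\top Y$. Suppose the weight $W_Y$ in the metric $\bar g^{r+}_Y$ satisfies $W_Y=OW_{YO}O^\top$ for all $Y\in\mathbb{R}^{p\times r}_*$ and $O\in\mathbb{O}_r$. Then $$\operatorname{grad} f(X)=\tfrac12\Big(\overline{\operatorname{grad}h_{r+}([Y])}\,W_YY^\dagger+\big(\overline{\operatorname{grad}h_{r+}([Y])}\,W_YY^\dagger\big)^\top(I_p-YY^\dagger)\Big),$$ $$\overline{\operatorname{grad}h_{r+}([Y])}=2\operatorname{grad}f(X)\,Y\,W_Y^{-1}.$$ Furthermore, if $[Y]$ is a Riemannian first-order stationary point of $h_{r+}$ on $\mathcal{M}^{q_1}_{r+}$, then $$\overline{\operatorname{Hess}h_{r+}([Y])}[\theta_Y,\theta_Y]=\operatorname{Hess}f(X)\big[\mathcal{L}^{r+}_Y(\theta_Y),\mathcal{L}^{r+}_Y(\theta_Y)\big]\qquad\forall\,\theta_Y\in\mathcal{H}_Y\overline{\mathcal{M}}^{q_1}_{r+}.$$ Finally (at such a point), $\overline{\operatorname{Hess}h_{r+}([Y])}$ and $\operatorname{Hess}f(X)$ both have $pr-(r^2-r)/2$ eigenvalues, and for $i=1,\dots,pr-(r^2-r)/2$, $\lambda_i(\overline{\operatorname{Hess}h_{r+}([Y])})$ is sandwiched between $2\sigma_r(PW_Y^{-1}P^\top)\,\lambda_i(\operatorname{Hess}f(X))$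 and $4\sigma_1(PW_Y^{-1}P^\top)\,\lambda_i(\operatorname{Hess}f(X))$.
   Context: Notation: $\mathbb{R}^{p\times r}_*$ = full-column-rank $p\times r$ matrices; $\mathrm{St}(r,p)$ = $p\times r$ matrices with orthonormal columns; $\mathbb{O}_r$ = $r\times r$ orthogonal matrices; $\mathbb{S}^{r\times r}$, $\mathbb{S}_+(r)$ = symmetric, resp. symmetric positive definite, $r\times r$ matrices; $U_\perp$ = orthonormal complement of $U$; $\dagger$ = Moore–Penrose inverse; $\sigma_i,\lambda_i$ = $i$-th largest singular value/eigenvalue. ''$a$ is sandwiched between $b$ and $c$'' means $\min\{b,c\}\le a\le\max\{b,c\}$. Objective: $f:\mathbb{R}^{p\times p}\to\mathbb{R}$ is twice continuously differentiable with $f(X)=f(X^\top)$. Embedded geometry: $\mathcal{M}^e_{r+}=\{X\in\mathbb{S}^{p\times p}:\operatorname{rank}X=r,\ X\succeq0\}$, an embedded submanifold of $\mathbb{R}^{p\times p}$ of dimension $pr-(r^2-r)/2$ with the metric induced by the Euclidean inner product $\langle A,B\rangle=\operatorname{tr}(A^\top B)$. $\operatorname{grad}f(X)$, $\operatorname{Hess}f(X)$ are the Riemannian gradient and Hessian of $f|_{\mathcal{M}^e_{r+}}$. Quotient geometry $\mathcal{M}^{q_1}_{r+}$: total space $\overline{\mathcal{M}}^{q_1}_{r+}=\mathbb{R}^{p\times r}_*$, equivalence classes $[Y]=\{YO:O\in\mathbb{O}_r\}$, $\mathcal{M}^{q_1}_{r+}=\mathbb{R}^{p\times r}_*/\mathbb{O}_r$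 with quotient map $\pi$. The total space carries the Riemannian metric $\bar g^{r+}_Y(\eta,\theta)=\operatorname{tr}(W_Y\eta^\top\theta)$, with $W_Y\in\mathbb{S}_+(r)$ depending smoothly on $Y$. The horizontal space at $Y$ is $$\mathcal{H}_Y\overline{\mathcal{M}}^{q_1}_{r+}=\{(US+U_\perp D)P^{-\top}:\ SP^{-\top}W_YP^{-1}\in\mathbb{S}^{r\times r},\ D\in\mathbb{R}^{(p-r)\times r}\},$$ where $U$ spans the column space of $Y$ and $P=U^\top Y$ (this is the $\bar g^{r+}_Y$-orthogonal complement of the tangent space of the fiber). The horizontal lift at $Y$ of a tangent vector $\theta_{[Y]}$ is the unique $\theta_Y\in\mathcal{H}_Y\overline{\mathcal{M}}^{q_1}_{r+}$ with $\mathrm{D}\pi(Y)[\theta_Y]=\theta_{[Y]}$; the quotient metric is $g^{r+}_{[Y]}(\eta_{[Y]},\theta_{[Y]})=\bar g^{r+}_Y(\eta_Y,\theta_Y)$. The function $Y\mapsto f(YY^\top)$ induces $h_{r+}$ on $\mathcal{M}^{q_1}_{r+}$, $h_{r+}([Y])=f(YY^\top)$. $\overline{\operatorname{grad}h_{r+}([Y])}$ is the horizontal lift at $Y$ of the Riemannian gradient of $h_{r+}$, and $\overline{\operatorname{Hess}h_{r+}([Y])}[\theta_Y,\eta_Y]=\operatorname{Hess}h_{r+}([Y])[\theta_{[Y]},\eta_{[Y]}]$ is the bilinear form of its Riemannian Hessian, on the horizontal space; its eigenvalues are those of the corresponding self-adjoint operator on $(\mathcal{H}_Y\overline{\mathcal{M}}^{q_1}_{r+},\bar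 g^{r+}_Y)$. A Riemannian first-order stationary point is a point where the Riemannian gradient vanishes. The map $\mathcal{L}^{r+}_Y:\mathcal{H}_Y\overline{\mathcal{M}}^{q_1}_{r+}\to T_X\mathcal{M}^e_{r+}$ is $\mathcal{L}^{r+}_Y(\theta_Y)=Y\theta_Y^\top+\theta_YY^\top$. *)

(* Defs.v *)
From HB Require Import structures.
From mathcomp Require Import all_boot all_order all_algebra.
From mathcomp Require Import all_classical all_reals all_analysis.
Set Implicit Arguments.
Unset Strict Implicit.
Unset Printing Implicit Defensive.
Import Order.TTheory GRing.Theory Num.Theory.
Import numFieldNormedType.Exports.
Local Open Scope classical_set_scope.
Local Open Scope ring_scope.

(* C^k on an open set A of a finite-dimensional space. *)
Fixpoint Ck {R : realType} {E F : normedModType R}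
    (k : nat) (A : set E) (phi : E -> F) : Prop :=
  match k with
  | 0 => forall x, A x -> {for x, continuous phi}
  | k'.+1 => (forall x, A x -> differentiable phi x) /\
             (forall v, Ck k' A ('D_v phi))
  end.

(* C^1 on a possibly non-open set M: local C^1 extensions exist.  The values of
   phi outside M are irrelevant. *)
Definition C1_on {R : realType} {E F : normedModType R}
    (M : set E) (phi : E -> F) : Prop :=
  forall x, M x -> exists (A : set E) (psi : E -> F),
    [/\ open A, A x, Ck 1 A psi & forall z, A z -> M z -> psi z = phi z].

Definition curve {R : realType} {E : normedModType R}
    (M : set E) (x v : E) (c : R -> E) : Prop :=
  [/\ \forall t \near (0 : R), M (c t), c 0 = x & is_derive (0 : R) 1 c v].

(* Velocities of curves of M through x; on an embedded submanifold asking the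
   curves to be smooth gives the same set. *)
Definition tangent_space {R : realType} {E : normedModType R}
    (M : set E) (x : E) : set E :=
  [set v | exists c : R -> E, curve M x v c].

(* d is the derivative of phi : M -> F at x along the tangent vector v. *)
Definition is_tderive {R : realType} {E F : normedModType R}
    (M : set E) (x v : E) (phi : E -> F) (d : F) : Prop :=
  forall c : R -> E, curve M x v c -> is_derive (0 : R) 1 (phi \o c) d.

(* A Riemannian manifold pts / grp, handled through horizontal lifts: pts is the
   total space, grp a group of linear bijections of E preserving pts, hsp and the
   metric, and hsp x is a complement in the tangent space of pts at x of the
   tangent space of the orbit of x.  A tangent vector of pts / grp at the orbit of
   x is represented by its horizontal lift in hsp x, a function on pts / grp by
   the invariant function it induces on pts, and a vector field by its horizontal
   lift, which is equivariant.  An embedded submanifold is the case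
   grp = {id}, hsp x = tangent_space pts x. *)
Record rmanifold (R : realType) (E : normedModType R) := RManifold {
  pts : set E;
  grp : set (E -> E);
  hsp : E -> set E;
  met : E -> E -> E -> R }.

Section Riemannian.
Context {R : realType} {E : normedModType R}.
Implicit Types (S : rmanifold E) (F : E -> R) (xi eta zeta : E -> E).

Definition orbit_of S (x : E) : set E := [set y | exists2 a, grp S a & y = a x].

(* The kernel of the differential at x of the projection pts -> pts / grp. *)
Definition vsp S (x : E) : set E := tangent_space (orbit_of S x) x.

Definition vector_field S xi : Prop :=
  [/\ C1_on (pts S) xi,
      forall x, pts S x -> hsp S x (xi x)
    & forall a x, grp S a -> pts S x -> xi (a x) = a (xi x)].

Definition scalar_field S F : Prop :=
  C1_on (pts S) F /\ forall a x, grp S a -> pts S x -> F (a x) = F x.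

Definition is_rgrad S F (x g : E) : Prop :=
  hsp S x g /\
  forall v, hsp S x v -> is_tderive (pts S) x v F (met S x g v).

Definition rgrad S F (x : E) : E := xget 0 [set g | is_rgrad S F x g].

(* nabla x v eta is the covariant derivative at x of the field eta along v.  In
   the torsion axiom, a - b is the Lie bracket of xi and eta at x; the bracket of
   the projected fields on pts / grp is the projection of a - b, hence the
   equality modulo vsp (which is {0} when grp = {id}).  As for any torsion-free
   metric connection, Koszul's formula determines nabla on hsp and vector fields,
   so its regularity and equivariance need not be required. *)
Record levi_civita S (nabla : E -> E -> (E -> E) -> E) : Prop := LeviCivita {
  nabla_hsp : forall x v eta, pts S x -> hsp S x v -> vector_field S eta ->
    hsp S x (nabla x v eta);
  nabla_linear : forall x (k : R) v w eta,
    pts S x -> hsp S x v -> hsp S x w -> vector_field S eta ->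
    nabla x (k *: v + w) eta = k *: nabla x v eta + nabla x w eta;
  nabla_add : forall x v eta zeta, pts S x -> hsp S x v ->
    vector_field S eta -> vector_field S zeta ->
    nabla x v (fun z => eta z + zeta z) = nabla x v eta + nabla x v zeta;
  nabla_leibniz : forall x v F eta (d : R), pts S x -> hsp S x v ->
    scalar_field S F -> vector_field S eta -> is_tderive (pts S) x v F d ->
    nabla x v (fun z => F z *: eta z) = F x *: nabla x v eta + d *: eta x;
  nabla_torsion : forall x xi eta a b, pts S x ->
    vector_field S xi -> vector_field S eta ->
    is_tderive (pts S) x (xi x) eta a -> is_tderive (pts S) x (eta x) xi b ->
    vsp S x (nabla x (xi x) eta - nabla x (eta x) xi - (a - b));
  nabla_metric : forall x v eta zeta, pts S x -> hsp S x v ->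
    vector_field S eta -> vector_field S zeta ->
    is_tderive (pts S) x v (fun z => met S z (eta z) (zeta z))
      (met S x (nabla x v eta) (zeta x) + met S x (eta x) (nabla x v zeta)) }.

Definition rhess_op S (nabla : E -> E -> (E -> E) -> E) F (x v : E) : E :=
  nabla x v (rgrad S F).

Definition rhess S (nabla : E -> E -> (E -> E) -> E) F (x v w : E) : R :=
  met S x (rhess_op S nabla F x v) w.

End Riemannian.

(* s lists in nonincreasing order, with multiplicity, the eigenvalues of the
   restriction of T to the subspace V; [size s] is then the dimension of V. *)
Definition eigenvalues_on {R : realType} {E : vectType R}
    (V : set E) (T : E -> E) (s : seq R) : Prop :=
  sorted >=%R s /\
  exists (n : nat) (b : n.-tuple E),
    [/\ free b, forall v, V v <-> v \in <<b>>%VS, forall v, V v -> V (T v) &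
        char_poly (\matrix_(i, j) coord b j (T b`_i)) =
          \prod_(x <- s) ('X - x%:P)].

Section Matrices.
Context {R : realType}.

Definition singular_values m n (A : 'M[R]_(m, n)) (s : seq R) : Prop :=
  [/\ sorted >=%R s, all (fun x => 0 <= x) s &
      char_poly (A^T *m A) = \prod_(x <- s) ('X - (x ^+ 2)%:P)].

(* The i-th largest singular value, i counted from 1. *)
Definition sigma m n (i : nat) (A : 'M[R]_(m, n)) : R :=
  (xget [::] [set s | singular_values A s])`_i.-1.

(* The Moore-Penrose inverse (mathcomp's pinvmx is only a generalized one). *)
Definition mpinv m n (A : 'M[R]_(m, n)) : 'M[R]_(n, m) :=
  xget 0 [set B | [/\ A *m B *m A = A, B *m A *m B = B,
                      (A *m B)^T = A *m B & (B *m A)^T = B *m A]].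

Definition sym n (A : 'M[R]_n) : Prop := A^T = A.

Definition orthonormal_cols m n (A : 'M[R]_(m, n)) : Prop := A^T *m A = 1%:M.

Definition psd n (A : 'M[R]_n) : Prop :=
  sym A /\ forall v : 'cV[R]_n, 0 <= (v^T *m A *m v) 0 0.

Definition spd n (A : 'M[R]_n) : Prop :=
  sym A /\ forall v : 'cV[R]_n, v != 0 -> 0 < (v^T *m A *m v) 0 0.

Definition full_col_rank p r : set 'M[R]_(p, r) := [set Y | \rank Y = r].

Definition psd_rank p r : set 'M[R]_p := [set X | psd X /\ \rank X = r].

Arguments full_col_rank : clear implicits.
Arguments psd_rank : clear implicits.

Definition embedded p r : rmanifold 'M[R]_p :=
  RManifold (psd_rank p r) [set id] (tangent_space (psd_rank p r))
    (fun _ A B => \tr (A^T *m B)).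

(* The equality of row spaces says that U spans the column space of Y. *)
Definition col_basis p r (Y U : 'M[R]_(p, r)) : Prop :=
  orthonormal_cols U /\ (U^T :=: Y^T)%MS.

Definition horizontal p r (W : 'M[R]_(p, r) -> 'M[R]_r) (Y : 'M[R]_(p, r)) :
    set 'M[R]_(p, r) :=
  [set theta | exists (U : 'M[R]_(p, r)) (Uperp : 'M[R]_(p, p - r))
                      (S : 'M[R]_r) (D : 'M[R]_(p - r, r)),
    let P := U^T *m Y in
    [/\ col_basis Y U,
        orthonormal_cols Uperp /\ U^T *m Uperp = 0,
        sym (S *m (invmx P)^T *m W Y *m invmx P) &
        theta = (U *m S + Uperp *m D) *m (invmx P)^T]].

Definition quotient p r (W : 'M[R]_(p, r) -> 'M[R]_r) : rmanifold 'M[R]_(p, r) :=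
  RManifold (full_col_rank p r)
    [set a | exists2 O : 'M[R]_r, orthonormal_cols O & a = fun Y => Y *m O]
    (horizontal W)
    (fun Y eta theta => \tr (W Y *m eta^T *m theta)).

Definition Lmap p r (Y theta : 'M[R]_(p, r)) : 'M[R]_p :=
  Y *m theta^T + theta *m Y^T.

End Matrices.

Arguments full_col_rank {R} p r.
Arguments psd_rank {R} p r.
Arguments embedded {R} p r.

Definition sandwiched {R : realType} (a b c : R) : Prop :=
  Num.min b c <= a <= Num.max b c.

(* Main.v *)
(** Write [nab f X] for the Euclidean gradient of [f] (a symmetric matrix at a
    symmetric [X]) and [N] for the projection onto the orthogonal of the range of
    [X = Y Y^T].  The tangent space at [X] is the set of symmetric [xi] with
    [N xi N = 0], so [grad f X = nab f X - N (nab f X) N], hence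
    [grad f (Z Z^T) Z = nab f (Z Z^T) Z] and [grad h Z = 2 grad f (Z Z^T) Z W^-1].

    At a critical point the Levi-Civita axioms are needed only through torsion:
    the covariant derivative of the gradient field along [v] is its ordinary
    derivative, up to a vertical vector in the quotient.  Along [c t = Y + t theta]
    let [a] be the derivative of [grad f (c c^T)].  Differentiating
    [grad h (c) W (c) = 2 grad f (c c^T) c] shows that both Hessians of [theta]
    and [theta'] equal [2 tr ((a Y)^T theta')].

    The eigenvalue bounds come from the Courant-Fischer dimension count, the map
    [L theta = Y theta^T + theta Y^T] being a bijection of the horizontal space onto
    the tangent space with
    [2 sigma_r g(theta, theta) <= |L theta|^2 <= 4 sigma_1 g(theta, theta)]. *)

(* The connections are known only through axioms about vector fields, so each tangent vector at the
   critical point must be exhibited as the value there of a C^1 equivariant field. Gradients of the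
   linear functions [frob v], and of the functions they induce on the quotient, provide these
   fields, so a single regularity proof for gradients serves the Hessians and the test fields alike.
   The symmetry of the Hessians is drawn from the equality of mixed second derivatives of [f].

   The constants 2 and 4 come from [|L theta|^2 = 2 |theta Y^T|^2 + 2 tr ((theta Y^T)^2)]: the trace
   is at most [|theta Y^T|^2], and horizontality makes it nonnegative. The factors [sigma_r] and
   [sigma_1] come from [V = theta P^T] and [A = P W^-1 P^T], for which [|theta Y^T| = |V|] and
   [g(theta, theta) = tr (V A^-1 V^T)]. The two Hessian operators are self-adjoint for different
   inner products on different spaces, hence a spectral theorem for an abstract inner product on a
   subspace. *)
Require Import Defs.
From HB Require Import structures.
From mathcomp Require Import all_boot all_order all_algebra.
From mathcomp Require Import all_classical all_reals all_analysis.
From mathcomp Require Import complex.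
From mathcomp Require Import ring lra zify.
Set Implicit Arguments.
Unset Strict Implicit.
Unset Printing Implicit Defensive.
Import Order.TTheory GRing.Theory Num.Theory.
Import numFieldNormedType.Exports.
Local Open Scope classical_set_scope.
Local Open Scope ring_scope.

(* det((M - a)^2 + b^2) = det(M - z) det(M - z^* ) for a complex eigenvalue
   z = a + ib of M. *)
Lemma real_quadratic_singular (R : rcfType) n (M : 'M[R]_n) : (0 < n)%N ->
  exists a b : R, \det ((M - a%:M) *m (M - a%:M) + (b ^+ 2)%:M) = 0.
Proof.
move=> n0; pose N := map_mx (real_complex R) M.
have /closed_rootP [z rz] : size (char_poly N) != 1%N.
  by rewrite size_char_poly; case: (n) n0.
have dz : \det (N - z%:M) = 0.
  have /eqP := rz; rewrite /char_poly -horner_evalE -det_map_mx /= => d.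
  have := detZ (-1) (N - z%:M).
  rewrite (_ : -1 *: _ = map_mx (horner_eval z) (char_poly_mx N)).
    by rewrite d => /esym/eqP; rewrite mulf_eq0 signr_eq0 => /eqP.
  apply/matrixP => i j; rewrite !mxE /horner_eval !hornerE /=.
  by case: (i == j); rewrite /= ?hornerE ?mulr1n ?mulr0n; ring.
exists (complex.Re z), (complex.Im z); apply: complexI.
rewrite -det_map_mx rmorph0.
set a := complex.Re z; set b := complex.Im z.
(* [c] is [i b]: thus [z = a' + c], its conjugate is [a' - c], and [c * c] is [- b ^+ 2]. *)
pose c : complex R := (Complex 0 b); pose a' := real_complex R a.
have -> : map_mx (real_complex R) ((M - a%:M) *m (M - a%:M) + (b ^+ 2)%:M)
    = (N - z%:M) *m (N - (a' - c)%:M).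
  rewrite map_mxD map_mxM map_mxB !map_scalar_mx /= -/N -/a'.
  have -> : z = a' + c by rewrite /a' /c /a /b; case: (z) => x y; simpc.
  have -> : real_complex R (b ^+ 2) = - (c * c).
    by rewrite /c; simpc; rewrite expr2.
  have -> : N - (a' + c)%:M = N - a'%:M - c%:M by rewrite raddfD /= opprD addrA.
  have -> : N - (a' - c)%:M = N - a'%:M + c%:M.
    by rewrite raddfB /= opprB addrA addrAC.
  move: (N - a'%:M) => A.
  rewrite mulmxBl !mulmxDr [A *m c%:M]mul_mx_scalar [c%:M *m A]mul_scalar_mx.
  by rewrite -scalar_mxM raddfN /= opprD addrA addrK.
by rewrite det_mulmx dz mul0r.
Qed.

(** * Spectral theorem and Rayleigh quotients for an abstract real inner product *)

Section InnerProduct.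
Context {R : realType} {E : vectType R}.
Implicit Types (ip : E -> E -> R) (V : {vspace E}) (s : seq E) (T : E -> E).

Record inner_product ip : Prop := InnerProduct {
  ipC : forall u v, ip u v = ip v u;
  ip_linear : forall k u v w, ip (k *: u + v) w = k * ip u w + ip v w;
  ip_gt0 : forall u, u != 0 -> 0 < ip u u }.

Definition orthonormal ip s : Prop :=
  uniq s /\ {in s &, forall u v, ip u v = (u == v)%:R}.

(** Linearity is restricted to [V] because the operators of interest are covariant derivatives,
    whose axioms concern horizontal vectors only. *)
Definition linear_on V T : Prop := forall (k : R) u v,
  u \in V -> v \in V -> T (k *: u + v) = k *: T u + T v.

Definition self_adjoint_on ip V T : Prop :=
  [/\ linear_on V T, {in V, forall u, T u \in V} &
      {in V &, forall u v, ip (T u) v = ip u (T v)}].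

Section Theory.
Context {ip : E -> E -> R} (ipP : inner_product ip).

Lemma ip0 u : ip 0 u = 0.
Proof.
have := ip_linear ipP (-1) 0 0 u; rewrite scaler0 addr0 mulN1r.
by move->; rewrite addNr.
Qed.

Lemma ipD u v w : ip (u + v) w = ip u w + ip v w.
Proof. by have := ip_linear ipP 1 u v w; rewrite scale1r mul1r. Qed.

Lemma ipZ k u w : ip (k *: u) w = k * ip u w.
Proof. by have := ip_linear ipP k u 0 w; rewrite !addr0 ip0 addr0. Qed.

Lemma ipB u v w : ip (u - v) w = ip u w - ip v w.
Proof. by rewrite ipD -scaleN1r ipZ mulN1r. Qed.

Lemma ip_suml I (r : seq I) (P : pred I) (F : I -> E) w :
  ip (\sum_(i <- r | P i) F i) w = \sum_(i <- r | P i) ip (F i) w.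
Proof.
elim/big_rec2: _ => [|i x y _ <-]; first exact: ip0.
exact: ipD.
Qed.

Lemma ip_ge0 u : 0 <= ip u u.
Proof. by have [->|/(ip_gt0 ipP)/ltW//] := eqVneq u 0; rewrite ip0. Qed.

Lemma ip_eq0 u : ip u u = 0 -> u = 0.
Proof. by move=> u0; apply/eqP/negP => /negP/(ip_gt0 ipP); rewrite u0 ltxx. Qed.

Lemma linear_on0 V T : linear_on V T -> T 0 = 0.
Proof.
move=> TL; have := TL (-1) 0 0 (mem0v _) (mem0v _).
by rewrite scaler0 addr0 scaleN1r addNr.
Qed.

Lemma linear_on_sum V T I (r : seq I) (k : I -> R) (F : I -> E) :
  linear_on V T -> (forall i, F i \in V) ->
  T (\sum_(i <- r) k i *: F i) = \sum_(i <- r) k i *: T (F i).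
Proof.
move=> TL FV; elim: r => [|i r IH]; first by rewrite !big_nil (linear_on0 TL).
rewrite !big_cons TL ?IH //.
by apply: rpred_sum => j _; apply: rpredZ.
Qed.

(* If ((T - a)^2 + b^2) x = 0 then |(T - a) x|^2 = - b^2 |x|^2. *)
Lemma self_adjoint_eigenvector V T : self_adjoint_on ip V T -> (V != 0)%VS ->
  exists2 u, u \in V /\ u != 0 & exists l, T u = l *: u.
Proof.
move=> [TL TV TS] V0; pose X := vbasis V.
have XV i : X`_i \in V.
  have [iX|iX] := ltnP i (size X); first exact/vbasis_mem/mem_nth.
  by rewrite nth_default ?mem0v.
have n0 : (0 < \dim V)%N by rewrite lt0n dimv_eq0.
(* Row [i] holds the coordinates of the image of the [i]-th basis vector, so [T] acts on coordinate
   rows by right multiplication and [v] lies in a left kernel. *)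
pose M : 'M[R]_(\dim V) := \matrix_(i, j) coord X j (T X`_i).
have [a [b /eqP/det0P[v v0 vM]]] := real_quadratic_singular M n0.
pose phi (w : 'rV[R]_(\dim V)) := \sum_i w 0 i *: X`_i.
have phiV w : phi w \in V by apply: rpred_sum => j _; apply: rpredZ.
have phiM w : T (phi w) = phi (w *m M).
  rewrite /phi (linear_on_sum _ _ TL) //.
  under eq_bigr => i _ do rewrite {1}(coord_vbasis (TV _ (XV i))) scaler_sumr.
  rewrite exchange_big /=; apply: eq_bigr => j _.
  rewrite mxE scaler_suml; apply: eq_bigr => i _.
  by rewrite scalerA mxE.
have phiZ k w : phi (k *: w) = k *: phi w.
  by rewrite /phi scaler_sumr; apply: eq_bigr => i _; rewrite mxE scalerA.
have phiD w w' : phi (w + w') = phi w + phi w'.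
  by rewrite /phi -big_split; apply: eq_bigr => i _; rewrite mxE scalerDl.
pose x := phi v; pose w := phi (v *m (M - a%:M)).
have subE u : phi (u *m (M - a%:M)) = T (phi u) - a *: phi u.
  by rewrite mulmxBr mul_mx_scalar -scaleNr phiD phiZ phiM scaleNr.
have wE : w = T x - a *: x by exact: subE.
have TwE : T w - a *: w = - (b ^+ 2) *: x.
  apply/eqP; rewrite scaleNr -addr_eq0 -subE -phiZ -phiD -mulmxA -mul_mx_scalar.
  rewrite -mulmxDr vM; apply/eqP.
  by rewrite /phi big1 // => i _; rewrite mxE scale0r.
have w0 : ip w w = - (b ^+ 2) * ip x x.
  rewrite -ipZ -TwE {1}wE ipD -scaleNr ipZ TS ?phiV //.
  by rewrite ipD -scaleNr ipZ (ipC ipP x) (ipC ipP x w).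
have : ip w w = 0.
  apply/eqP; rewrite eq_le ip_ge0 andbT w0 mulNr oppr_le0.
  by rewrite mulr_ge0 ?sqr_ge0 ?ip_ge0.
move=> /ip_eq0; rewrite wE => /eqP; rewrite subr_eq0 => /eqP Tx.
exists x; last by exists a.
split; first exact: phiV.
apply: contraNneq v0 => x0; apply/eqP/rowP => i; rewrite mxE.
have /freeP := basis_free (vbasisP V); apply; exact: x0.
Qed.

Lemma orthonormal_free s : orthonormal ip s -> free s.
Proof.
move=> [su so]; rewrite -[s]in_tupleE; apply/freeP => k ks i.
have := congr1 (fun x => ip x s`_i) ks; rewrite ip0 ip_suml (bigD1 i) //=.
rewrite ipZ so ?mem_nth // eqxx mulr1 big1 ?addr0 // => j ji.
by rewrite ipZ so ?mem_nth // nth_uniq // val_eqE (negbTE ji) mulr0.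
Qed.

Lemma orthonormal_span s x : orthonormal ip s -> x \in << s >>%VS ->
  x = \sum_(u <- s) ip x u *: u.
Proof.
move=> [su so]; rewrite -[s]in_tupleE => /coord_span {1 2}->.
move: (fun i => coord (in_tuple s) i x) => c.
rewrite [RHS](big_nth 0) big_mkord /=; apply: eq_bigr => i _.
congr (_ *: _); rewrite ip_suml (bigD1 i) //= ipZ so ?mem_nth // eqxx mulr1.
rewrite big1 ?addr0 // => j ji.
by rewrite ipZ so ?mem_nth // nth_uniq // val_eqE (negbTE ji) mulr0.
Qed.


Lemma orthonormal_sub s s' : orthonormal ip s -> uniq s' -> {subset s' <= s} ->
  orthonormal ip s'.
Proof. by move=> [su so] s'u ss'; split=> // u v us vs; apply: so; exact: ss'. Qed.

Lemma ip_coord s u v : orthonormal ip s -> u \in << s >>%VS ->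
  ip u v = \sum_(w <- s) ip u w * ip v w.
Proof.
move=> so us; rewrite {1}(orthonormal_span so us) ip_suml.
by apply: eq_bigr => w _; rewrite ipZ (ipC ipP w).
Qed.

(** The orthogonal of [u] in [V] is obtained as the image of [V] under the projection along [u],
    which fixes exactly the vectors orthogonal to [u]. *)
Lemma orthogonal_decomp u V : u \in V -> ip u u = 1 ->
  exists V' : {vspace E}, forall x, (x \in V') = (x \in V) && (ip x u == 0).
Proof.
move=> uV u1; pose pi x := x - ip x u *: u.
have pil : linear pi.
  move=> k x y; rewrite /pi (ip_linear ipP) scalerDl scalerBr scalerA.
  by rewrite opprD addrACA.
pose piM := GRing.isLinear.Build _ _ _ _ _ pil.
pose piL : {linear _ -> _} := HB.pack pi piM.
exists (linfun piL @: V)%VS => x; apply/memv_imgP/andP => [[y yV ->]|[xV /eqP xu]].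
  rewrite lfunE /= /pi; split; first by rewrite rpredB ?rpredZ.
  by rewrite ipD -scaleNr ipZ u1 mulr1 subrr.
by exists x => //; rewrite lfunE /= /pi xu scale0r subr0.
Qed.

Theorem spectral V T : self_adjoint_on ip V T ->
  exists s, [/\ orthonormal ip s, << s >>%VS = V,
    {in s, forall u, T u = ip (T u) u *: u} &
    sorted >=%R [seq ip (T u) u | u <- s]].
Proof.
move=> TV.
(* The order is imposed afterwards by sorting. The induction on the dimension splits off a unit
   eigenvector and goes on with its orthogonal in [V], which [T] preserves by self-adjointness. *)
suff [s [so sV sT]] : exists s, [/\ orthonormal ip s, << s >>%VS = V &
    {in s, forall u, T u = ip (T u) u *: u}].
  exists (sort (fun u v => ip (T v) v <= ip (T u) u) s); split.
  - apply: (orthonormal_sub so) => [|u]; rewrite ?sort_uniq ?mem_sort //.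
    by case: so.
  - by rewrite -sV; apply: eq_span => u; rewrite mem_sort.
  - by move=> u; rewrite mem_sort; exact: sT.
  - by rewrite sorted_map; apply: sort_sorted => u v; exact: le_total.
have [n] := ubnP (\dim V); elim: n => // n IH in V TV *; rewrite ltnS => Vn.
have [V0|V0] := eqVneq V 0%VS.
  exists [::]; split => //; first by rewrite span_nil V0.
have [x [xV x0] [l Tx]] := self_adjoint_eigenvector TV V0.
have [TL TVV TS] := TV.
have nx := ip_gt0 ipP x0.
pose u := (Num.sqrt (ip x x))^-1 *: x.
have uV : u \in V by exact: rpredZ.
have u1 : ip u u = 1.
  rewrite ipZ (ipC ipP) ipZ mulrA -expr2 exprVn sqr_sqrtr ?ip_ge0 //.
  by rewrite mulVf // gt_eqF.
have Tu : T u = l *: u.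
  by have := TL (Num.sqrt (ip x x))^-1 x 0 xV (mem0v _);
    rewrite (linear_on0 TL) !addr0 -/u => ->; rewrite Tx /u !scalerA mulrC.
have [V' V'E] := orthogonal_decomp uV u1.
have V'V : (V' <= V)%VS by apply/subvP => y; rewrite V'E => /andP[].
have uV' : u \notin V' by rewrite V'E u1 oner_eq0 andbF.
have dV' : (\dim V' < n)%N.
  apply: leq_trans Vn; rewrite ltn_neqAle dimvS // andbT.
  by apply: contraNneq uV' => e; have /eqP-> : V' == V by rewrite eqEdim V'V e /=.
have TV' : self_adjoint_on ip V' T.
  split=> [k y z yV zV|y|y z yV zV].
  - by apply: TL; exact: (subvP V'V).
  - rewrite !V'E => /andP[yV /eqP yu]; rewrite TVV //= TS // Tu.
    by rewrite (ipC ipP) ipZ (ipC ipP) yu mulr0.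
  - by apply: TS; exact: (subvP V'V).
have [s [so sV sT]] := IH _ TV' dV'.
have sV' y : y \in s -> y \in V' by rewrite -sV; exact: memv_span.
have su y : y \in s -> ip y u = 0 by move=> /sV'; rewrite V'E => /andP[_ /eqP].
exists (u :: s); split.
- split=> /=; first by rewrite (contra (@sV' u)) //=; case: so.
  move=> y z; rewrite !inE => /orP[/eqP->|ys] /orP[/eqP->|zs].
  + by rewrite eqxx u1.
  + rewrite (ipC ipP) su //; have [uz|//] := eqVneq.
    by move: uV'; rewrite uz sV'.
  + rewrite su //; have [uz|//] := eqVneq.
    by move: uV'; rewrite -uz sV'.
  + by case: so => _ ->.
- apply/eqP; rewrite eqEsubv; apply/andP; split.
    apply/span_subvP => y; rewrite inE => /orP[/eqP->//|/sV'].
    exact: (subvP V'V).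
  apply/subvP => y yV; rewrite -[y](subrK (ip y u *: u)).
  apply: rpredD; last by apply/rpredZ/memv_span/mem_head.
  suff: y - ip y u *: u \in V'.
    rewrite -sV; apply/subvP/sub_span => z zs; rewrite inE zs orbT //.
  rewrite V'E rpredB ?rpredZ //=.
  by rewrite ipD -scaleNr ipZ u1 mulr1 subrr.
- move=> y; rewrite inE => /orP[/eqP->|/sT//].
  by rewrite Tu ipZ u1 mulr1.
Qed.

Lemma orthonormal_dim s V : orthonormal ip s -> << s >>%VS = V -> size s = \dim V.
Proof.
move=> /orthonormal_free sf sV.
by rewrite (@size_basis _ _ _ _ (in_tuple s)) //= /basis_of sV sf eqxx.
Qed.

Lemma spectral_eigenvalues V T s : self_adjoint_on ip V T ->
  orthonormal ip s -> << s >>%VS = V ->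
  {in s, forall u, T u = ip (T u) u *: u} ->
  sorted >=%R [seq ip (T u) u | u <- s] ->
  eigenvalues_on (fun x => x \in V) T [seq ip (T u) u | u <- s].
Proof.
move=> [TL TV _] so sV sT ss; split => //.
exists (size s), (in_tuple s); have sf := orthonormal_free so.
split; [exact: sf|by move=> v; rewrite sV|exact: TV|].
rewrite char_poly_trig.
  rewrite big_map (big_nth 0) big_mkord; apply: eq_bigr => i _.
  rewrite mxE /= sT ?mem_nth // linearZ /= coord_free // eqxx mulr1.
  by rewrite -sT ?mem_nth.
apply/is_trig_mxP => i j ij; rewrite mxE /= sT ?mem_nth // linearZ /=.
by rewrite coord_free // -val_eqE /= (ltn_eqF ij) mulr0.
Qed.


End Theory.

(** The family [s] may span less than [V]: the uses are with initial and final segments of an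
    eigenbasis. *)
Lemma rayleigh ip V T s x : inner_product ip -> self_adjoint_on ip V T ->
  orthonormal ip s -> {subset s <= V} ->
  {in s, forall u, T u = ip (T u) u *: u} -> x \in << s >>%VS ->
  ip (T x) x = \sum_(u <- s) ip (T u) u * ip x u ^+ 2.
Proof.
move=> ipP [TL TV TS] so sV sT xs.
have xV : x \in V by apply: subvP xs; apply/span_subvP.
rewrite (ipC ipP) (ip_coord ipP _ so xs) !big_seq; apply: eq_bigr => u us.
have -> : ip (T x) u = ip (T u) u * ip x u.
  by rewrite (TS _ _ xV (sV _ us)) {1}(sT _ us) (ipC ipP) ipZ // (ipC ipP u x).
by ring.
Qed.

Lemma rayleigh_le ip V T s x c : inner_product ip -> self_adjoint_on ip V T ->
  orthonormal ip s -> {subset s <= V} ->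
  {in s, forall u, T u = ip (T u) u *: u} -> x \in << s >>%VS ->
  {in s, forall u, ip (T u) u <= c} -> ip (T x) x <= c * ip x x.
Proof.
move=> ipP TV so sV sT xs sc; rewrite (rayleigh ipP TV so) //.
rewrite [ip x x](ip_coord ipP _ so xs) mulr_sumr !big_seq.
by apply: ler_sum => u us; rewrite -expr2 ler_wpM2r ?sqr_ge0 ?sc.
Qed.

Lemma rayleigh_ge ip V T s x c : inner_product ip -> self_adjoint_on ip V T ->
  orthonormal ip s -> {subset s <= V} ->
  {in s, forall u, T u = ip (T u) u *: u} -> x \in << s >>%VS ->
  {in s, forall u, c <= ip (T u) u} -> c * ip x x <= ip (T x) x.
Proof.
move=> ipP TV so sV sT xs sc; rewrite (rayleigh ipP TV so) //.
rewrite [ip x x](ip_coord ipP _ so xs) mulr_sumr !big_seq.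
by apply: ler_sum => u us; rewrite -expr2 ler_wpM2r ?sqr_ge0 ?sc.
Qed.

(** The two segments share the index [i], so an initial segment of one eigenbasis and a final
    segment of another have sizes adding up to the dimension plus one, the surplus that
    [common_vector] needs. *)
Lemma sorted_eigenbasis ip V T s i : orthonormal ip s -> << s >>%VS = V ->
  {in s, forall u, T u = ip (T u) u *: u} ->
  sorted >=%R [seq ip (T u) u | u <- s] -> (i < size s)%N ->
  let l := [seq ip (T u) u | u <- s] in
  [/\ {in take i.+1 s, forall u, l`_i <= ip (T u) u} &
      {in drop i s, forall u, ip (T u) u <= l`_i}].
Proof.
move=> so sV sT ss si l.
have le_l j k : (j <= k)%N -> (k < size s)%N -> l`_k <= l`_j.
  move=> jk kV; have := sorted_leq_nth (rev_trans le_trans) (@lexx _ _) 0 ss.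
  by move=> /(_ j k); apply; rewrite ?inE ?size_map //; lia.
split=> u /(nthP 0)[k]; rewrite ?size_take ?size_drop => ks <-.
  have ki : (k <= i)%N by case: ifP ks; lia.
  rewrite nth_take //; have := le_l _ _ ki si.
  by rewrite [l`_k](nth_map 0) // (leq_ltn_trans ki).
rewrite nth_drop; have ik : (i + k < size s)%N by rewrite -ltn_subRL.
by have := le_l _ _ (leq_addr k i) ik; rewrite [l`_(i + k)](nth_map 0).
Qed.

End InnerProduct.

(** * Comparison of eigenvalues through a linear bijection with two-sided norm bounds *)

Section Ostrowski.
Context {R : realType} {E F : vectType R}.
Context {ipE : E -> E -> R} {ipF : F -> F -> R}.
Hypotheses (ipEP : inner_product ipE) (ipFP : inner_product ipF).
Context {V : {vspace E}} {W : {vspace F}} {T : E -> E} {S : F -> F}.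
Hypotheses (TV : self_adjoint_on ipE V T) (SW : self_adjoint_on ipF W S).
Context {L : 'Hom(E, F)} (LVW : (L @: V)%VS = W).
Context {a b : R} (a_gt0 : 0 < a).
Hypothesis L_bound :
  {in V, forall x, a * ipE x x <= ipF (L x) (L x) <= b * ipE x x}.
Hypothesis TSL : {in V, forall x, ipE (T x) x = ipF (S (L x)) (L x)}.
Context {s : seq E} {t : seq F}.
Hypotheses (so : orthonormal ipE s) (sV : << s >>%VS = V)
  (sT : {in s, forall u, T u = ipE (T u) u *: u})
  (to : orthonormal ipF t) (tW : << t >>%VS = W)
  (tS : {in t, forall u, S u = ipF (S u) u *: u}).
Let l := [seq ipE (T u) u | u <- s].
Let m := [seq ipF (S u) u | u <- t].
Hypotheses (ls : sorted >=%R l) (ms : sorted >=%R m).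

Lemma bounded_ker0 : (V :&: lker L = 0)%VS.
Proof.
apply/eqP; rewrite -subv0; apply/subvP => x; rewrite memv_cap memv_ker memv0.
move=> /andP[xV /eqP Lx]; have /andP[] := L_bound xV; rewrite Lx ip0 // => h _.
apply/eqP/(ip_eq0 ipEP)/le_anti; rewrite ip_ge0 // andbT.
by rewrite -(pmulr_rle0 _ a_gt0).
Qed.

Lemma bounded_dim : \dim W = \dim V.
Proof. by rewrite -LVW limg_dim_eq ?bounded_ker0. Qed.

(** [L] is injective on [V], so the image of the first span and the second span are subspaces of [W]
    whose dimensions add up to more than that of [W]; they meet outside zero. *)
Lemma common_vector s' t' : uniq s' -> uniq t' -> {subset s' <= s} ->
  {subset t' <= t} -> (\dim V < size s' + size t')%N ->
  exists x, [/\ x != 0, x \in << s' >>%VS & L x \in << t' >>%VS].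
Proof.
move=> s'u t'u s's t't Vst.
have s'o := orthonormal_sub so s'u s's; have t'o := orthonormal_sub to t'u t't.
have s'V : (<< s' >> <= V)%VS by rewrite -sV sub_span.
have t'W : (<< t' >> <= W)%VS by rewrite -tW sub_span.
have Ls'W : (L @: << s' >> <= W)%VS by rewrite -LVW limgS.
have dL : \dim (L @: << s' >>) = size s'.
  rewrite (orthonormal_dim ipEP s'o erefl) limg_dim_eq //.
  by apply/eqP; rewrite -subv0 -bounded_ker0 capvS.
have dt' := orthonormal_dim ipFP t'o erefl.
have := dimv_sum_cap (L @: << s' >>) << t' >>.
have : (\dim (L @: << s' >> + << t' >>) <= \dim W)%N.
  by rewrite dimvS // subv_add Ls'W.
rewrite bounded_dim -dt' dL => h1 h2.
have : (L @: << s' >> :&: << t' >>)%VS != 0%VS.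
  by rewrite -dimv_eq0 -lt0n -(ltn_add2l (\dim (L @: << s' >> + << t' >>)))
    addn0 h2 (leq_ltn_trans h1).
move=> n0; set y := vpick (L @: << s' >> :&: << t' >>)%VS.
have y0 : y != 0 by rewrite vpick0.
have /memv_capP[/memv_imgP[x xs yL] yt] : y \in (L @: << s' >> :&: << t' >>)%VS.
  exact: memv_pick.
exists x; split=> //; last by rewrite -yL.
by apply: contraNneq y0 => x0; rewrite yL x0 linear0.
Qed.

Lemma sandwiched_eigenvalues i : (i < \dim V)%N ->
  sandwiched l`_i (a * m`_i) (b * m`_i).
Proof.
move=> iV.
have ss := orthonormal_dim ipEP so sV.
have st : size t = \dim V by rewrite (orthonormal_dim ipFP to tW) bounded_dim.
have [su _] := so; have [tu _] := to.
have [tt ts] : [/\ {in take i.+1 t, forall u, m`_i <= ipF (S u) u} &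
    {in drop i t, forall u, ipF (S u) u <= m`_i}].
  by apply: sorted_eigenbasis tW tS _ _; rewrite ?st.
have [st' ss'] : [/\ {in take i.+1 s, forall u, l`_i <= ipE (T u) u} &
    {in drop i s, forall u, ipE (T u) u <= l`_i}].
  by apply: sorted_eigenbasis sV sT _ _; rewrite ?ss.
have subV s' : {subset s' <= s} -> {subset s' <= V}.
  by move=> s's u /s's us; rewrite -sV memv_span.
have subW t' : {subset t' <= t} -> {subset t' <= W}.
  by move=> t't u /t't ut; rewrite -tW memv_span.
(* The sign of [c] decides which of [a * c] and [b * c] is the smaller; this is why the conclusion
   is a sandwich. *)
have min_max (c x y : R) : 0 < y -> a * y <= x <= b * y ->
    Num.min (a * c) (b * c) * y <= c * x <= Num.max (a * c) (b * c) * y.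
  move=> y0 /andP[ax xb]; have ab : a <= b by rewrite -(ler_pM2r y0) (le_trans ax).
  have [c0|c0] := leP 0 c.
    by rewrite min_l ?max_r ?ler_wpM2r // ![_ * c]mulrC -!mulrA !ler_wpM2l.
  have c0' := ltW c0; rewrite min_r ?max_l ?ler_wnM2r //.
  by rewrite ![_ * c]mulrC -!mulrA !ler_wnM2l.
(* On [x] the Rayleigh quotient of [T] is at most the [i]-th eigenvalue of [T], while on [L x] that
   of [S] is at least the [i]-th eigenvalue of [S]: this gives the lower bound. *)
have [x [x0 xs xt]] : exists x, [/\ x != 0, x \in << drop i s >>%VS &
    L x \in << take i.+1 t >>%VS].
  apply: common_vector; rewrite ?drop_uniq ?take_uniq //.
  - exact: mem_drop.
  - exact: mem_take.
  - by rewrite size_drop size_take ss st; case: ifP; lia.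
(* The segments exchange roles, which gives the upper bound. *)
have [y [y0 ys yt]] : exists y, [/\ y != 0, y \in << take i.+1 s >>%VS &
    L y \in << drop i t >>%VS].
  apply: common_vector; rewrite ?drop_uniq ?take_uniq //.
  - exact: mem_take.
  - exact: mem_drop.
  - by rewrite size_drop size_take ss st; case: ifP; lia.
have spanV s' z : {subset s' <= s} -> z \in << s' >>%VS -> z \in V.
  by move=> s's; apply: subvP; rewrite -sV sub_span.
have xV := spanV _ _ (@mem_drop _ _ _) xs.
have yV := spanV _ _ (@mem_take _ _ _) ys.
have x1 : m`_i * ipF (L x) (L x) <= l`_i * ipE x x.
  apply: (@le_trans _ _ (ipF (S (L x)) (L x))).
    apply: (rayleigh_ge ipFP SW _ _ _ xt tt).
    - by apply: orthonormal_sub to _ _; [rewrite take_uniq|exact: mem_take].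
    - by apply: subW; exact: mem_take.
    - by move=> u /mem_take; exact: tS.
  rewrite -TSL //; apply: (rayleigh_le ipEP TV _ _ _ xs ss').
  - by apply: orthonormal_sub so _ _; [rewrite drop_uniq|exact: mem_drop].
  - by apply: subV; exact: mem_drop.
  - by move=> u /mem_drop; exact: sT.
have y1 : l`_i * ipE y y <= m`_i * ipF (L y) (L y).
  apply: (@le_trans _ _ (ipF (S (L y)) (L y))).
    rewrite -TSL //; apply: (rayleigh_ge ipEP TV _ _ _ ys st').
    - by apply: orthonormal_sub so _ _; [rewrite take_uniq|exact: mem_take].
    - by apply: subV; exact: mem_take.
    - by move=> u /mem_take; exact: sT.
  apply: (rayleigh_le ipFP SW _ _ _ yt ts).
  - by apply: orthonormal_sub to _ _; [rewrite drop_uniq|exact: mem_drop].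
  - by apply: subW; exact: mem_drop.
  - by move=> u /mem_drop; exact: tS.
have px := ip_gt0 ipEP x0; have py := ip_gt0 ipEP y0.
have /andP[mx _] := min_max m`_i _ _ px (L_bound xV).
have /andP[_ my] := min_max m`_i _ _ py (L_bound yV).
rewrite /sandwiched -(ler_pM2r px) (le_trans mx x1) /=.
by rewrite -(ler_pM2r py) (le_trans y1 my).
Qed.

End Ostrowski.

(** * Frobenius product, positive definite matrices and orthonormal bases *)

Section RealMatrices.
Context {R : realType}.

Definition frob m n (A B : 'M[R]_(m, n)) : R := \tr (A^T *m B).

Lemma frobE m n (A B : 'M[R]_(m, n)) : frob A B = \sum_i \sum_j A i j * B i j.
Proof.
rewrite /frob /mxtrace exchange_big /=; apply: eq_bigr => j _.
by rewrite mxE; apply: eq_bigr => i _; rewrite mxE.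
Qed.

Lemma frobC m n (A B : 'M[R]_(m, n)) : frob A B = frob B A.
Proof. by rewrite /frob -mxtrace_tr trmx_mul trmxK. Qed.

Lemma frob_linear m n k (A B C : 'M[R]_(m, n)) :
  frob (k *: A + B) C = k * frob A C + frob B C.
Proof. by rewrite /frob linearP /= mulmxDl -scalemxAl linearP. Qed.

Lemma frob_tr m n (A B : 'M[R]_(m, n)) : frob A^T B^T = frob A B.
Proof. by rewrite /frob mxtrace_mulC trmxK -mxtrace_tr trmx_mul trmxK. Qed.

Lemma frob_ge0 m n (A : 'M[R]_(m, n)) : 0 <= frob A A.
Proof. by rewrite frobE; do 2!apply: sumr_ge0 => ? _; rewrite -expr2 sqr_ge0. Qed.

Lemma frob_eq0 m n (A : 'M[R]_(m, n)) : frob A A = 0 -> A = 0.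
Proof.
rewrite frobE => /eqP; rewrite psumr_eq0 => [/allP A0|i _]; last first.
  by apply: sumr_ge0 => j _; rewrite -expr2 sqr_ge0.
apply/matrixP => i j; rewrite mxE; apply/eqP.
have := A0 i (mem_index_enum i); rewrite psumr_eq0 => [/allP Ai|k _]; last first.
  by rewrite -expr2 sqr_ge0.
by have := Ai j (mem_index_enum j); rewrite mulf_eq0 orbb.
Qed.

Lemma frob_inner_product m n : inner_product (@frob m n).
Proof.
split; [exact: frobC|by move=> *; exact: frob_linear|move=> A A0].
rewrite lt_def frob_ge0 andbT; apply: contra A0 => /eqP/frob_eq0->; exact: eqxx.
Qed.

Lemma mx_spectral n (A : 'M[R]_n) : sym A ->
  exists (Q : 'M[R]_n) (l : 'rV[R]_n),
    Q *m Q^T = 1%:M /\ A = Q^T *m diag_mx l *m Q.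
Proof.
move=> As; pose T (u : 'rV[R]_n) := u *m A.
have TA : self_adjoint_on (@frob 1 n) fullv T.
  split=> [k u v _ _|u _|u v _ _]; rewrite ?memvf //.
    by rewrite /T mulmxDl scalemxAl.
  by rewrite /frob /T trmx_mul As -mulmxA mxtrace_mulC mulmxA mxtrace_mulC.
have [s [so sV sT _]] := spectral (@frob_inner_product 1 n) TA.
have sn : size s = n.
  rewrite (orthonormal_dim (@frob_inner_product 1 n) so sV) dimvf dim_matrix.
  exact: mul1n.
pose Q := \matrix_(i < n) s`_i; pose l : 'rV[R]_n := \row_i frob (T s`_i) s`_i.
have QQ : Q *m Q^T = 1%:M.
  apply/matrixP => i j; rewrite !mxE; have [su so'] := so.
  have := so' s`_i s`_j; rewrite !mem_nth ?sn // => /(_ isT isT).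
  rewrite nth_uniq ?sn // frobE big_ord_recl big_ord0 addr0 => <-.
  by apply: eq_bigr => k _; rewrite !mxE.
exists Q, l; split=> //.
rewrite -[LHS]mul1mx -(mulmx1C QQ) -!mulmxA; congr (_ *m _).
apply/row_matrixP => i; rewrite row_mul rowK -/(T _) {1}sT ?mem_nth ?sn //.
by apply/rowP => j; rewrite mul_diag_mx !mxE.
Qed.

Lemma spd_quadratic n (A : 'M[R]_n) (v : 'cV[R]_n) : spd A -> v != 0 ->
  0 < \tr (v^T *m A *m v).
Proof. by move=> [_ h] /h; rewrite /mxtrace big_ord_recl big_ord0 addr0. Qed.

Lemma spd_spectral n (A : 'M[R]_n) : spd A ->
  exists (Q : 'M[R]_n) (l : 'rV[R]_n),
    [/\ Q *m Q^T = 1%:M, A = Q^T *m diag_mx l *m Q & forall i, 0 < l 0 i].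
Proof.
move=> Ap; have [As _] := Ap; have [Q [l [QQ AE]]] := mx_spectral As.
exists Q, l; split=> // i.
(* Row [i] of [Q] is a unit eigenvector for [l 0 i], so the quadratic form takes that value on
   it. *)
have Qi : row i Q *m Q^T = delta_mx 0 i by rewrite -row_mul QQ row1.
have q0 : (row i Q)^T != 0.
  rewrite -trmx0 (inj_eq trmx_inj); apply/eqP => q0.
  have := congr1 (fun M : 'rV_n => M 0 i) Qi; rewrite q0 mul0mx !mxE !eqxx.
  by move/esym/eqP; rewrite oner_eq0.
have := spd_quadratic Ap q0.
have Qi' : Q *m (row i Q)^T = delta_mx i 0.
  by rewrite -[Q *m _]trmxK trmx_mul trmxK Qi trmx_delta.
rewrite trmxK AE !mulmxA Qi -mulmxA Qi' -rowE -colE /mxtrace big_ord1 !mxE.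
by rewrite eqxx.
Qed.

(** Such a factor turns a norm weighted by [A] into a Frobenius norm: [tr (A V^T V) = |V C|^2]. *)
Lemma spd_factor n (A : 'M[R]_n) : spd A ->
  exists2 C : 'M[R]_n, C \in unitmx & A = C *m C^T.
Proof.
move=> /spd_spectral[Q [l [QQ AE lp]]].
pose D : 'M[R]_n := diag_mx (\row_i Num.sqrt (l 0 i)).
have DD : D *m D = diag_mx l.
  rewrite mulmx_diag; congr diag_mx; apply/rowP => i.
  by rewrite !mxE -expr2 sqr_sqrtr // ltW.
exists (Q^T *m D).
  rewrite unitmx_mul; apply/andP; split; first by case: (mulmx1_unit QQ).
  rewrite unitmxE det_diag unitfE prodf_seq_neq0; apply/allP => i _.
  by rewrite mxE gt_eqF // sqrtr_gt0.
by rewrite trmx_mul trmxK tr_diag_mx mulmxA -(mulmxA Q^T) DD.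
Qed.

Lemma full_gram_spd m n (A : 'M[R]_(m, n)) : \rank A = n -> spd (A^T *m A).
Proof.
move=> rA; split=> [|v v0]; first by rewrite /sym trmx_mul trmxK.
rewrite mulmxA -mulmxA -trmx_mul.
have -> : ((A *m v)^T *m (A *m v)) 0 0 = frob (A *m v) (A *m v).
  by rewrite /frob /mxtrace big_ord_recl big_ord0 addr0.
apply: (ip_gt0 (frob_inner_product _ _)).
have At : row_free A^T by rewrite /row_free mxrank_tr rA.
by rewrite -trmx_eq0 trmx_mul (mulmx_free_eq0 _ At) trmx_eq0.
Qed.

Lemma spd_unit n (A : 'M[R]_n) : spd A -> A \in unitmx.
Proof. by move=> /spd_factor[C Cu ->]; rewrite unitmx_mul unitmx_tr Cu. Qed.

Lemma orthonormal_cols_rank m n (A : 'M[R]_(m, n)) :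
  orthonormal_cols A -> \rank A = n.
Proof.
move=> AA; apply/eqP; rewrite eqn_leq rank_leq_col /=.
by rewrite -{1}(mxrank1 R n) -AA mxrankM_maxr.
Qed.

(** In place of Gram-Schmidt, a row basis [B] is normalised by the factor [C] of its Gram matrix
    [B B^T = C C^T]. *)
Lemma orthonormal_basis m n k (M : 'M[R]_(m, n)) : \rank M = k ->
  exists2 U : 'M[R]_(n, k), orthonormal_cols U & (U^T :=: M)%MS.
Proof.
move=> <-; pose B := row_base M.
have Bf := row_base_free M.
have [C Cu CE] : exists2 C : 'M[R]_(\rank M), C \in unitmx & B *m B^T = C *m C^T.
  apply: spd_factor; rewrite -{1}[B]trmxK; apply: full_gram_spd.
  by rewrite mxrank_tr; exact/eqP.
exists (B^T *m invmx C^T).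
  rewrite /orthonormal_cols trmx_mul trmxK -mulmxA (mulmxA B) CE trmx_inv trmxK.
  by rewrite !mulmxA mulVmx // mul1mx mulmxV ?unitmx_tr.
rewrite trmx_mul trmxK trmx_inv trmxK.
apply: eqmx_trans (eq_row_base M); apply: eqmxMfull.
by rewrite row_full_unit unitmx_inv.
Qed.

End RealMatrices.

(** * Singular values of a positive definite matrix *)

Section SingularValues.
Context {R : realType}.

Lemma char_poly_orthogonal n (Q A : 'M[R]_n) : Q *m Q^T = 1%:M ->
  char_poly (Q^T *m A *m Q) = char_poly A.
Proof.
move=> QQ; pose QX := map_mx polyC Q.
have QQX : QX^T *m QX = 1%:M.
  by rewrite /QX map_trmx -map_mxM (mulmx1C QQ) map_scalar_mx.
rewrite /char_poly; transitivity (\det (QX^T *m char_poly_mx A *m QX)).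
  congr (\det _); rewrite /char_poly_mx mulmxBr mulmxBl.
  by rewrite scalar_mxC -(mulmxA _ QX^T QX) QQX mulmx1 !map_mxM map_trmx.
by rewrite !det_mulmx mulrAC -det_mulmx QQX det1 mul1r.
Qed.

Lemma char_poly_diag n (l : 'rV[R]_n) :
  char_poly (diag_mx l) = \prod_(i < n) ('X - (l 0 i)%:P).
Proof.
rewrite char_poly_trig ?diag_mx_is_trig //; apply: eq_bigr => i _.
by rewrite mxE eqxx mulr1n.
Qed.

Lemma sorted_head_last (s : seq R) x : sorted >=%R s -> x \in s ->
  s`_(size s).-1 <= x <= s`_0.
Proof.
move=> ss /(nthP 0)[i si <-].
have le_s j k : (j <= k)%N -> (k < size s)%N -> s`_k <= s`_j.
  move=> jk ks; apply: (sorted_leq_nth (rev_trans le_trans) (@lexx _ _) 0 ss) => //.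
  by rewrite inE (leq_ltn_trans jk).
by rewrite !le_s //; case: (size s) si.
Qed.

(** [sigma] reads a list picked by [xget], so the argument must hold for any admissible list: the
    characteristic polynomial of [A^T A] forces its squares to be those of the [l 0 i], and
    nonnegativity removes the sign ambiguity. The sorted [l] shows that an admissible list
    exists. *)
Lemma sigma_spectral n (Q A : 'M[R]_n) (l : 'rV[R]_n) : (0 < n)%N ->
  Q *m Q^T = 1%:M -> A = Q^T *m diag_mx l *m Q -> (forall i, 0 < l 0 i) ->
  0 < sigma n A /\ forall i, sigma n A <= l 0 i <= sigma 1 A.
Proof.
move=> n0 QQ AE lp.
have cE : char_poly (A^T *m A) = \prod_(i < n) ('X - (l 0 i ^+ 2)%:P).
  rewrite {1}AE !trmx_mul trmxK tr_diag_mx {1}AE !mulmxA.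
  rewrite -(mulmxA (_ *m diag_mx l) Q Q^T) QQ mulmx1.
  rewrite -(mulmxA Q^T) mulmx_diag char_poly_orthogonal // char_poly_diag.
  by apply: eq_bigr => i _; rewrite mxE expr2.
have svE : singular_values A (sort >=%R (codom (l 0))).
  split; first by apply: sort_sorted => x y; exact: le_total.
    by rewrite all_sort; apply/allP => _ /codomP[i ->]; exact: ltW.
  rewrite cE (perm_big (codom (l 0))) ?perm_sort //=.
  by rewrite /codom /image_mem big_map big_enum.
rewrite /sigma; case: xgetP => [s _ [ss s0 sE]|/(_ _ svE)//].
have sn : size s = n.
  have := size_char_poly (A^T *m A).
  by rewrite sE -(big_map (fun x => x ^+ 2) predT (fun x => 'X - x%:P))
    size_prod_XsubC size_map => -[].
have mem x : (x ^+ 2 \in [seq y ^+ 2 | y <- s]) = [exists i, x ^+ 2 == l 0 i ^+ 2].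
  rewrite -root_prod_XsubC big_map -sE cE.
  rewrite -(big_map (fun i => l 0 i ^+ 2) predT (fun x => 'X - x%:P)).
  rewrite root_prod_XsubC; apply/mapP/existsP => [[i _ ->]|[i /eqP->]].
    by exists i.
  by exists i => //; rewrite mem_index_enum.
have ls i : l 0 i \in s.
  have /mapP[x xs /eqP] : l 0 i ^+ 2 \in [seq y ^+ 2 | y <- s].
    by rewrite mem; apply/existsP; exists i.
  by rewrite eqrXn2 // => [/eqP->//||]; [exact: ltW|exact: (allP s0)].
split=> [|i]; last by have := sorted_head_last ss (ls i); rewrite sn.
have sin : s`_n.-1 \in s by rewrite mem_nth // sn prednK.
(* A zero last entry would make 0 one of the squares [l 0 i ^+ 2]. *)
rewrite lt_def (allP s0) // andbT; apply/eqP => s_0.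
have : s`_n.-1 ^+ 2 \in [seq y ^+ 2 | y <- s] by apply: map_f.
rewrite mem s_0 expr0n /= => /existsP[i /eqP/esym/eqP].
by rewrite expf_eq0 /= gt_eqF.
Qed.

(** In the eigenbasis, with [B = V Q^T], the norm is the sum of the squares of the entries of [B]
    and the trace is the same sum with weights [1 / l_j]; the bounds hold term by term. *)
Lemma sigma_inverse_bounds m n (A : 'M[R]_n) (V : 'M[R]_(m, n)) :
  (0 < n)%N -> spd A ->
  sigma n A * \tr (V *m invmx A *m V^T) <= frob V V
    <= sigma 1 A * \tr (V *m invmx A *m V^T).
Proof.
move=> n0 /spd_spectral[Q [l [QQ AE lp]]].
have [_ sl] := sigma_spectral n0 QQ AE lp.
have Ai : invmx A = Q^T *m diag_mx (\row_i (l 0 i)^-1) *m Q.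
  have AB : A *m (Q^T *m diag_mx (\row_i (l 0 i)^-1) *m Q) = 1%:M.
    rewrite AE !mulmxA -(mulmxA (_ *m diag_mx l)) QQ mulmx1 -(mulmxA Q^T).
    rewrite mulmx_diag (_ : diag_mx _ = 1%:M) ?mulmx1 ?(mulmx1C QQ) //.
    apply/matrixP => i j; rewrite !mxE; case: eqP => // _.
    by rewrite mulfV // gt_eqF.
  by have [Au _] := mulmx1_unit AB; rewrite -[LHS]mulmx1 -AB mulKmx.
pose B := V *m Q^T.
have -> : frob V V = \sum_i \sum_j B i j ^+ 2.
  rewrite (_ : frob V V = frob B B).
    by rewrite frobE; do 2!(apply: eq_bigr => ? _); rewrite expr2.
  rewrite /frob /B trmx_mul trmxK !mulmxA [RHS]mxtrace_mulC !mulmxA.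
  by rewrite (mulmx1C QQ) mul1mx.
have -> : \tr (V *m invmx A *m V^T) = \sum_i \sum_j (l 0 j)^-1 * B i j ^+ 2.
  have -> : V *m invmx A *m V^T = B *m diag_mx (\row_i (l 0 i)^-1) *m B^T.
    by rewrite Ai /B trmx_mul trmxK !mulmxA.
  apply: eq_bigr => i _; rewrite mxE; apply: eq_bigr => j _.
  by rewrite mul_mx_diag !mxE expr2 -mulrA mulrCA mulrA.
rewrite !mulr_sumr; apply/andP; split; apply: ler_sum => i _;
  rewrite mulr_sumr; apply: ler_sum => j _; rewrite mulrA;
  have /andP[s1 s2] := sl j.
  by rewrite ler_piMl ?sqr_ge0 // ler_pdivrMr ?mul1r.
by rewrite ler_peMl ?sqr_ge0 // ler_pdivlMr ?mul1r.
Qed.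

End SingularValues.

(** * Linear algebra of the horizontal space and of the map [Lmap Y] *)

Section LinearGeometry.
Context {R : realType}.

Lemma proj_sub m n k (M : 'M[R]_(m, n)) (U : 'M[R]_(n, k)) :
  orthonormal_cols U -> (M <= U^T)%MS -> M *m U *m U^T = M.
Proof.
by move=> UU /submxP[D ->]; rewrite -(mulmxA D) UU mulmx1.
Qed.

Lemma orthonormal_complement p r (U : 'M[R]_(p, r)) : orthonormal_cols U ->
  exists Uperp : 'M[R]_(p, p - r), [/\ orthonormal_cols Uperp,
    U^T *m Uperp = 0 & U *m U^T + Uperp *m Uperp^T = 1%:M].
Proof.
move=> UU.
have rk : \rank (kermx U) = (p - r)%N.
  by rewrite mxrank_ker (orthonormal_cols_rank UU).
have [V VV VE] := orthonormal_basis rk.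
have VU : V^T *m U = 0 by apply/sub_kermxP; rewrite VE.
have UV : U^T *m V = 0 by rewrite -[V]trmxK -trmx_mul VU trmx0.
exists V; split=> //; apply/eqP; rewrite eq_sym -subr_eq0 opprD addrA; apply/eqP.
(* The rows of [F] lie in the left kernel of [U], which the rows of [V^T] span, and [F] also kills
   [V]; hence [F] is zero. *)
set F := 1%:M - _ - _.
have FU : F *m U = 0.
  by rewrite !mulmxBl mul1mx -mulmxA UU mulmx1 -mulmxA VU mulmx0 subrr subr0.
have FV : F *m V = 0.
  by rewrite !mulmxBl mul1mx -mulmxA UV mulmx0 -mulmxA VV mulmx1 subr0 subrr.
have FK : (F <= V^T)%MS by rewrite VE; exact/sub_kermxP.
by rewrite -(proj_sub VV FK) FV mul0mx.
Qed.

Lemma sym_congr m n (A : 'M[R]_n) (B : 'M[R]_(m, n)) :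
  sym A -> sym (B *m A *m B^T).
Proof. by move=> As; rewrite /sym !trmx_mul trmxK As mulmxA. Qed.

Lemma col_basisE p r (Z U : 'M[R]_(p, r)) : \rank Z = r -> col_basis Z U ->
  U *m (U^T *m Z) = Z /\ U^T *m Z \in unitmx.
Proof.
move=> rZ [UU UZ].
have e : U *m (U^T *m Z) = Z.
  have := proj_sub UU (_ : (Z^T <= U^T)%MS); rewrite UZ => /(_ (submx_refl _)).
  by move/(congr1 trmx); rewrite !trmx_mul !trmxK.
split=> //; rewrite -row_full_unit /row_full eqn_leq rank_leq_col /=.
by rewrite -{1}rZ -{1}e mxrankM_maxr.
Qed.

(** With [Z = U P] one has [Z^T theta W = P^T (S P^-T W P^-1) P], so the two symmetry conditions are
    congruent. The new form no longer mentions a choice of [U] or of its complement. *)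
Lemma horizontalP p r (W : 'M[R]_(p, r) -> 'M[R]_r) (Z theta : 'M[R]_(p, r)) :
  \rank Z = r ->
  horizontal W Z theta <-> sym (Z^T *m theta *m W Z).
Proof.
move=> rZ; split.
  move=> [U [Up [S [D [UZ [VV UV] Ss ->]]]]].
  have [ZE Pu] := col_basisE rZ UZ; have [UU _] := UZ.
  move: (U^T *m Z) Ss ZE Pu => P Ss ZE Pu.
  have {1}-> : Z^T = P^T *m U^T by rewrite -trmx_mul ZE.
  rewrite -(mulmxA _ U^T) (mulmxA U^T) mulmxDr !mulmxA UU UV mul0mx addr0 mul1mx.
  have := sym_congr P^T Ss; rewrite trmxK !mulmxA.
  by rewrite -(mulmxA _ (invmx P) P) mulVmx // mulmx1.
have rZt : \rank Z^T = r by rewrite mxrank_tr.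
have [U UU UZ] := orthonormal_basis rZt.
have [Up [VV UV UUV]] := orthonormal_complement UU.
have [ZE Pu] := col_basisE rZ (conj UU UZ).
move=> Ss; pose P := U^T *m Z.
exists U, Up, (U^T *m theta *m P^T), (Up^T *m theta *m P^T) => /=.
rewrite /P; move: (U^T *m Z) ZE Pu => {}P ZE Pu.
have PP : P^T *m (invmx P)^T = 1%:M by rewrite -trmx_mul mulVmx // trmx1.
split=> //.
  rewrite -(mulmxA _ P^T) PP mulmx1.
  have := sym_congr (invmx P)^T Ss; rewrite trmxK !mulmxA.
  by rewrite -{1}ZE trmx_mul !mulmxA -trmx_mul mulmxV // trmx1 mul1mx.
rewrite mulmxDl -!mulmxA PP mulmx1 !mulmxA -mulmxDl UUV mul1mx //.
Qed.

Lemma invmx_mul n (A B : 'M[R]_n) : A \in unitmx -> B \in unitmx ->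
  invmx (A *m B) = invmx B *m invmx A.
Proof.
move=> Au Bu; have ABu : A *m B \in unitmx by rewrite unitmx_mul Au.
by rewrite -[RHS]mulmx1 -(mulmxV ABu) !mulmxA mulmxKV // mulVmx // mul1mx.
Qed.

Lemma linfunE (aT rT : vectType R) (g : aT -> rT) : linear g -> linfun g =1 g.
Proof.
move=> gl; pose gM := GRing.isLinear.Build _ _ _ _ _ gl.
by pose gL : {linear _ -> _} := HB.pack g gM; move=> x; rewrite (lfunE gL).
Qed.

Lemma dim_fullv_mx m n : \dim {: 'M[R]_(m, n)} = (m * n)%N.
Proof. by rewrite dimvf dim_matrix. Qed.

Definition skewv n : {vspace 'M[R]_n} :=
  lker (linfun (fun A : 'M[R]_n => A + A^T)).

Lemma mem_skewv n (A : 'M[R]_n) : (A \in skewv n) = (A^T == - A).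
Proof.
rewrite memv_ker linfunE => [|k B C]; first by rewrite addrC addr_eq0.
by rewrite linearP scalerDr addrACA.
Qed.

Lemma card_ord_pairs n :
  #|[set x : 'I_n * 'I_n | (x.1 < x.2)%N]%SET| = 'C(n, 2).
Proof.
rewrite -bin2_sum big_mkord -sum1dep_card.
rewrite -(pair_big_dep xpredT (fun i j : 'I_n => i < j)%N (fun _ _ => 1%N)) /=.
rewrite (exchange_big_dep xpredT) //=; apply: eq_bigr => j _.
by rewrite (big_ord_narrow (ltnW (ltn_ord j))) sum_nat_const card_ord muln1.
Qed.

(** The entries strictly above the diagonal are coordinates: they determine a skew matrix, and
    [B - B^T] realises any prescribed values. *)
Lemma dim_skewv n : \dim (skewv n) = 'C(n, 2).
Proof.
rewrite -card_ord_pairs; set I := [set x | _]%SET.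
pose g (A : 'M[R]_n) : 'rV[R]_#|I| :=
  \row_k A (enum_val k).1 (enum_val k).2.
have gl : linear g by move=> k A B; apply/rowP => i; rewrite !mxE.
have Ival (k : 'I_#|I|) : ((enum_val k).1 < (enum_val k).2)%N.
  by have := enum_valP k; rewrite inE.
have gker : (skewv n :&: lker (linfun g) = 0)%VS.
  apply/eqP; rewrite -subv0; apply/subvP => A.
  rewrite memv_cap mem_skewv memv_ker linfunE // memv0 => /andP[/eqP At /eqP gA].
  have Au (i j : 'I_n) : (i < j)%N -> A i j = 0.
    move=> ij; have ijI : (i, j) \in I by rewrite inE.
    have := congr1 (fun v : 'rV_ _ => v 0 (enum_rank_in ijI (i, j))) gA.
    by rewrite !mxE enum_rankK_in.
  have As i j : A i j = - A j i.
    by have := congr1 (fun M : 'M[R]_n => M j i) At; rewrite !mxE.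
  apply/eqP/matrixP => i j; rewrite mxE.
  have [ij|ij|ij] := ltngtP i j; first exact: Au.
    by rewrite As Au ?oppr0.
  apply/eqP; have := As i j; rewrite (ord_inj ij) => /eqP.
  by rewrite -addr_eq0 -mulr2n mulrn_eq0.
rewrite -(limg_dim_eq gker).
suff -> : (linfun g @: skewv n)%VS = fullv by rewrite dim_fullv_mx mul1n.
apply/eqP; rewrite eqEsubv subvf; apply/subvP => v _; apply/memv_imgP.
pose B : 'M[R]_n := \matrix_(i, j) \sum_k v 0 k *+ (enum_val k == (i, j)).
exists (B - B^T).
  by rewrite mem_skewv raddfB /= trmxK opprB.
rewrite linfunE //; apply/rowP => k; rewrite !mxE (bigD1 k) //= -surjective_pairing.
rewrite eqxx big1 ?addr0 => [|l lk]; last first.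
  by rewrite (inj_eq enum_val_inj) (negbTE lk).
rewrite big1 ?subr0 // => l _; case: eqP => // e.
by have := Ival l; rewrite e /= => /ltn_trans/(_ (Ival k)); rewrite ltnn.
Qed.

(* By [horizontalP], [horizontal W Y] is the set of members of [hvspace Y (W Y)]. *)
Definition hvspace p r (Y : 'M[R]_(p, r)) (W : 'M[R]_r) : {vspace 'M[R]_(p, r)} :=
  lker (linfun (fun theta => Y^T *m theta *m W - (Y^T *m theta *m W)^T)).

Lemma hvspace_linear p r (Y : 'M[R]_(p, r)) (W : 'M[R]_r) :
  linear (fun theta => Y^T *m theta *m W - (Y^T *m theta *m W)^T).
Proof.
move=> k A B; rewrite mulmxDr mulmxDl -scalemxAr -scalemxAl linearP /=.
by rewrite opprD addrACA scalerBr.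
Qed.

Lemma mem_hvspace p r (Y theta : 'M[R]_(p, r)) (W : 'M[R]_r) :
  reflect (sym (Y^T *m theta *m W)) (theta \in hvspace Y W).
Proof.
rewrite memv_ker linfunE; last exact: hvspace_linear.
by rewrite subr_eq0 eq_sym; exact: eqP.
Qed.

Lemma rank_gram_unit p r (Y : 'M[R]_(p, r)) : \rank Y = r -> Y^T *m Y \in unitmx.
Proof. by move=> /full_gram_spd/spd_unit. Qed.

(** Rank-nullity: the map whose kernel is [hvspace Y W] is onto the skew matrices,
    [Y (Y^T Y)^-1 A W^-1 / 2] being a preimage of [A]. *)
Lemma dim_hvspace p r (Y : 'M[R]_(p, r)) (W : 'M[R]_r) : \rank Y = r ->
  W \in unitmx -> (\dim (hvspace Y W) + 'C(r, 2))%N = (p * r)%N.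
Proof.
move=> rY Wu; have := limg_ker_dim (linfun (fun theta =>
  Y^T *m theta *m W - (Y^T *m theta *m W)^T)) fullv.
rewrite capfv -/(hvspace Y W) dim_fullv_mx => <-; rewrite -dim_skewv.
congr (_ + \dim _)%N; apply/eqP; rewrite eqEsubv; apply/andP; split.
  apply/subvP => A; rewrite mem_skewv => /eqP As; apply/memv_imgP.
  exists (2^-1 *: (Y *m invmx (Y^T *m Y) *m A *m invmx W)) => //.
    exact: memvf.
  rewrite linfunE; last exact: hvspace_linear.
  rewrite -scalemxAr !mulmxA mulmxV ?rank_gram_unit // mul1mx.
  rewrite -scalemxAl mulmxKV // linearZ /= As scalerN opprK -scalerDl.
  by rewrite (_ : 2^-1 + 2^-1 = 1) ?scale1r //; lra.
apply/subvP => _ /memv_imgP[theta _ ->].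
rewrite linfunE; last exact: hvspace_linear.
by rewrite mem_skewv raddfB /= trmxK opprB.
Qed.

Lemma Lmap_linear p r (Y : 'M[R]_(p, r)) : linear (Lmap Y).
Proof.
move=> k A B; rewrite /Lmap linearP /= mulmxDr mulmxDl -scalemxAr -scalemxAl.
by rewrite scalerDr addrACA.
Qed.

Lemma Lmap_ker p r (Y theta : 'M[R]_(p, r)) : \rank Y = r -> Lmap Y theta = 0 ->
  exists2 A : 'M[R]_r, A^T = - A & theta = Y *m A.
Proof.
move=> rY; have Gu := rank_gram_unit rY.
move=> /eqP; rewrite /Lmap addrC addr_eq0 => /eqP L0.
(* Multiplying [theta Y^T = - Y theta^T] by [Y] on the right and cancelling the Gram matrix gives
   this [A]. *)
pose A := - (theta^T *m Y *m invmx (Y^T *m Y)).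
have tE : theta = Y *m A.
  apply: (can_inj (mulmxK Gu)).
  by rewrite mulmxN mulNmx !mulmxA L0 -!mulmxA mulVmx // mulmx1 mulNmx !mulmxA.
exists A => //.
have : Y^T *m Y *m (A + A^T) *m (Y^T *m Y) = 0.
  have <- : Y^T *m (Y *m A *m Y^T + Y *m A^T *m Y^T) *m Y = 0.
    by rewrite -(mulmxA _ A^T) -trmx_mul -tE L0 addNr mulmx0 mul0mx.
  by rewrite -mulmxDl -mulmxDr !mulmxA.
move/(congr1 (mulmx^~ (invmx (Y^T *m Y)))); rewrite mulmxK // mul0mx.
move/(congr1 (mulmx (invmx (Y^T *m Y)))); rewrite mulKmx // mulmx0.
by move/eqP; rewrite addrC addr_eq0 => /eqP.
Qed.

Lemma mulmx_trmx_rank_eq0 p r m (Y : 'M[R]_(p, r)) (theta : 'M[R]_(m, r)) :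
  \rank Y = r -> theta *m Y^T = 0 -> theta = 0.
Proof.
move=> rY /eqP; rewrite mulmx_free_eq0 ?/row_free ?mxrank_tr ?rY //.
by move=> /eqP.
Qed.

(** Expansion of the square; the inequality is the nonnegativity of [|A^T - A|^2]. *)
Lemma frob_symmetrization n (A : 'M[R]_n) :
  frob (A^T + A) (A^T + A) = 2 * frob A A + 2 * \tr (A *m A) /\
  \tr (A *m A) <= frob A A.
Proof.
have AA : frob A^T A = \tr (A *m A) by rewrite /frob trmxK.
have e : frob (A^T + A) (A^T + A) = 2 * frob A A + 2 * \tr (A *m A).
  have := ipD (@frob_inner_product R n n); rewrite /= => D.
  rewrite !D ![frob _ (A^T + A)]frobC !D frob_tr (frobC A) AA; ring.
split=> //.
have : 0 <= frob (A^T - A) (A^T - A) by exact: frob_ge0.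
have -> : frob (A^T - A) (A^T - A) = 2 * frob A A - 2 * \tr (A *m A).
  have D := ipD (@frob_inner_product R n n).
  have N (B C : 'M[R]_n) : frob (- B) C = - frob B C.
    by rewrite -scaleN1r (ipZ (@frob_inner_product R n n)) mulN1r.
  rewrite !D N ![frob _ (A^T - A)]frobC !D !N frob_tr (frobC A) AA; ring.
by rewrite subr_ge0 ler_pM2l.
Qed.

(* With [B] the symmetric matrix [Y^T theta W] and [W^-1 = C C^T], one has
   [tr ((Y^T theta)^2) = |C^T B C|^2]. *)
Lemma Lmap_bound p r (Y theta : 'M[R]_(p, r)) (W : 'M[R]_r) :
  spd W -> theta \in hvspace Y W ->
  2 * frob (theta *m Y^T) (theta *m Y^T) <= frob (Lmap Y theta) (Lmap Y theta)
    <= 4 * frob (theta *m Y^T) (theta *m Y^T).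
Proof.
move=> Wp /mem_hvspace Bs; have Wu := spd_unit Wp.
have [D Du WE] := spd_factor Wp.
rewrite /Lmap -[Y *m theta^T]trmxK trmx_mul trmxK.
have [-> le1] := frob_symmetrization (theta *m Y^T).
suff t0 : 0 <= \tr (theta *m Y^T *m (theta *m Y^T)).
  by apply/andP; split; [lra|lra].
set B := Y^T *m theta *m W in Bs.
have YtE : Y^T *m theta = B *m invmx W by rewrite mulmxK.
have WiE : invmx W = (invmx D)^T *m invmx D.
  by rewrite WE invmx_mul ?unitmx_tr // trmx_inv.
pose S := invmx D *m B *m (invmx D)^T.
have Ss : S^T = S by exact: sym_congr.
have -> : \tr (theta *m Y^T *m (theta *m Y^T)) = frob S S.
  transitivity (\tr (Y^T *m theta *m (Y^T *m theta))).
    by rewrite -!mulmxA mxtrace_mulC !mulmxA.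
  rewrite YtE WiE /frob Ss /S -!mulmxA [RHS]mxtrace_mulC.
  by rewrite -!mulmxA.
exact: frob_ge0.
Qed.

(** The kernel of [Lmap Y] contains the [Y A] with [A] skew, so its rank is at most
    [p r - 'C(r, 2)]. That is the dimension of the horizontal space, on which the map is injective
    by [Lmap_bound]. *)
Lemma Lmap_horizontal_onto p r (Y eta : 'M[R]_(p, r)) (W : 'M[R]_r) :
  \rank Y = r -> spd W -> exists2 theta, theta \in hvspace Y W &
    Lmap Y theta = Lmap Y eta.
Proof.
move=> rY Wp; have Wu := spd_unit Wp; pose L := linfun (Lmap Y).
have LE : L =1 Lmap Y by apply: linfunE; exact: Lmap_linear.
have inj : (hvspace Y W :&: lker L = 0)%VS.
  apply/eqP; rewrite -subv0; apply/subvP => theta.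
  rewrite memv_cap [_ \in lker L]memv_ker memv0 LE => /andP[tH /eqP Lt].
  apply/eqP/(mulmx_trmx_rank_eq0 rY)/frob_eq0/le_anti; rewrite frob_ge0 andbT.
  have := Lmap_bound Wp tH; rewrite Lt /frob mulmx0 mxtrace0; lra.
pose M := linfun (mulmx Y : 'M[R]_(r, r) -> 'M[R]_(p, r)).
have ME : M =1 mulmx Y by move=> A; rewrite lfunE.
have Mker : (M @: skewv r <= lker L)%VS.
  apply/subvP => _ /memv_imgP[A As ->]; rewrite memv_ker LE ME /Lmap.
  rewrite mem_skewv in As; rewrite trmx_mul (eqP As).
  by rewrite mulNmx mulmxN mulmxA addNr.
have Minj : (skewv r :&: lker M = 0)%VS.
  apply/eqP; rewrite -subv0; apply/subvP => A.
  rewrite memv_cap [_ \in lker M]memv_ker memv0 ME => /andP[_ /eqP A0]; apply/eqP.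
  by rewrite -(mulKmx (rank_gram_unit rY) A) -(mulmxA Y^T) A0 !mulmx0.
have dker := dimvS Mker; rewrite limg_dim_eq // dim_skewv in dker.
have LH : (L @: hvspace Y W = limg L)%VS.
  apply/eqP; rewrite eqEdim limgS ?subvf //= (limg_dim_eq inj).
  have := limg_ker_dim L fullv; rewrite capfv dim_fullv_mx.
  have := dim_hvspace rY Wu; lia.
have : L eta \in (L @: hvspace Y W)%VS by rewrite LH memv_img ?memvf.
by case/memv_imgP => theta tH; rewrite !LE => e; exists theta.
Qed.

End LinearGeometry.

(** * Derivatives along curves and C^1 matrix-valued maps *)

Section Calculus.
Context {R : realType} {E : normedModType R}.

Lemma is_derive_ext (F G : normedModType R) (f g : F -> G) x v d d' :
  f =1 g -> d = d' -> is_derive x v f d -> is_derive x v g d'.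
Proof. by move=> /funext-> ->. Qed.

Lemma is_derive_mxP m n (M : E -> 'M[R]_(m, n)) x v (D : 'M[R]_(m, n)) :
  is_derive x v M D <-> forall i j, is_derive x v (fun z => M z i j) (D i j).
Proof.
split=> [[Mx <-] i j|h].
  have Mij := (derivable_mxP M x v).1 Mx i j.
  by rewrite (derive_mx Mx) mxE; exact: derivableP.
have Mx : derivable M x v by apply/derivable_mxP => i j; have [] := h i j.
apply: DeriveDef => //; rewrite (derive_mx Mx); apply/matrixP => i j.
by rewrite mxE; have [_ ->] := h i j.
Qed.

Lemma is_derive_mulmx m n k (M : E -> 'M[R]_(m, n)) (N : E -> 'M[R]_(n, k))
    x v (dM : 'M[R]_(m, n)) (dN : 'M[R]_(n, k)) :
  is_derive x v M dM -> is_derive x v N dN ->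
  is_derive x v (fun z => M z *m N z) (dM *m N x + M x *m dN).
Proof.
move=> /is_derive_mxP hM /is_derive_mxP hN; apply/is_derive_mxP => i j.
apply: (is_derive_ext (f := \sum_(l < n) (fun z => M z i l) * (fun z => N z l j))
  _ _ (is_derive_sum (fun l => is_deriveM (hM i l) (hN l j)))).
  by move=> z; rewrite mxE fct_sumE.
rewrite !mxE -big_split; apply: eq_bigr => l _ /=.
by rewrite addrC -[in RHS](mulrC (N x l j)).
Qed.

Lemma is_derive_trmx m n (M : E -> 'M[R]_(m, n)) x v (dM : 'M[R]_(m, n)) :
  is_derive x v M dM -> is_derive x v (fun z => (M z)^T) dM^T.
Proof.
move=> /is_derive_mxP hM; apply/is_derive_mxP => i j; rewrite mxE.
by apply: is_derive_ext (hM j i) => // z; rewrite mxE.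
Qed.

Lemma is_derive_comp (F : normedModType R) (c : R -> E) (phi : E -> F) (t : R) v :
  is_derive t 1 c v -> differentiable phi (c t) ->
  is_derive t 1 (phi \o c) ('D_v phi (c t)).
Proof.
move=> [cd <-] dphi; have /derivable1_diffP cd' := cd.
have dd : differentiable (phi \o c) t by exact: differentiable_comp.
apply: DeriveDef; first exact/derivable1_diffP.
by rewrite !deriveE // diff_comp.
Qed.

Lemma is_derive_line (x v : E) (t : R) : is_derive t 1 (fun s : R => x + s *: v) v.
Proof.
have d : is_diff t (fun s : R => x + s *: v) ( *:%R^~ v).
  by apply: (is_diff_eq (is_diffD (is_diff_cst x t) (is_diff_scalel t v)));
    apply/funext => s; rewrite /= add0r.
have dd := @ex_diff _ _ _ _ _ _ _ d.
apply: DeriveDef; first exact/derivable1_diffP.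
by rewrite deriveE // diff_val scale1r.
Qed.

Lemma is_derive_unique (F G : normedModType R) (f : F -> G) x v d d' :
  is_derive x v f d -> is_derive x v f d' -> d = d'.
Proof. by move=> [_ <-] [_ <-]. Qed.


Lemma continuous_on_open (F : topologicalType) (A : set E) (g h : E -> F) x :
  open A -> A x -> (forall y, A y -> g y = h y) ->
  {for x, continuous g} -> {for x, continuous h}.
Proof.
move=> Ao Ax gh gx; rewrite /prop_for /continuous_at -(gh x Ax).
apply: cvg_trans gx; apply: near_eq_cvg.
by near=> y; apply: gh; near: y; exact: open_nbhs_nbhs.
Unshelve. all: by end_near. Qed.

Lemma derive_on_open (F : normedModType R) (A : set E) (g h : E -> F) x v :
  open A -> A x -> (forall y, A y -> g y = h y) -> 'D_v g x = 'D_v h x.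
Proof.
move=> Ao Ax gh; apply: near_eq_derive; near=> y.
by apply: gh; near: y; exact: open_nbhs_nbhs.
Unshelve. all: by end_near. Qed.

(** The first-order expansion of [g] at [x] is also one of [h], and [diff_unique] then identifies
    the differential of [h]. *)
Lemma differentiable_on_open (F : normedModType R) (A : set E) (g h : E -> F) x :
  open A -> A x -> (forall y, A y -> g y = h y) ->
  differentiable g x -> differentiable h x.
Proof.
move=> Ao Ax gh gd.
have key : h \o shift x = cst (h x) + 'd g x +o_ (0 : E) id.
  apply/eqaddoP => e e0; have /eqaddoP/(_ e e0) := diff_locally gd.
  apply: filter_app; near=> y; rewrite -(gh _ Ax) /=.
  suff -> : (h \o shift x - (cst (g x) + 'd g x)) y =
    (g \o shift x - (cst (g x) + 'd g x)) y by [].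
  congr (_ - _); rewrite /= gh //; near: y.
  have : \forall y \near x, A y by exact: open_nbhs_nbhs.
  by rewrite (near_shift 0) subr0.
apply/diff_locallyP; rewrite (diff_unique _ key); last exact: diff_continuous.
by split; [exact: diff_continuous|exact: key].
Unshelve. all: by end_near. Qed.

Lemma continuous_mx m n (M : E -> 'M[R]_(m, n)) x :
  (forall i j, {for x, continuous (fun y => M y i j)}) -> {for x, continuous M}.
Proof.
move=> h; apply/cvgrPdist_le => e e0; near=> y.
rewrite /Num.Def.normr/= mx_normrE (bigmax_le _ (ltW e0))//= => i _.
rewrite !mxE; move: i; near: y; apply: filter_forall => i /=.
by have /cvgrPdist_le := h i.1 i.2; apply.
Unshelve. all: by end_near. Qed.

Lemma continuous_sum I (r : seq I) (P : pred I) (g : I -> E -> R) x :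
  (forall i, {for x, continuous (g i)}) ->
  {for x, continuous (fun y => \sum_(i <- r | P i) g i y)}.
Proof.
move=> gc; elim: r => [|i r IH].
  rewrite (_ : (fun y => _) = cst 0); first exact: cvg_cst.
  by apply/funext => y; rewrite big_nil.
rewrite (_ : (fun y => _) = fun y => (if P i then g i y else 0) +
    \sum_(j <- r | P j) g j y); last first.
  by apply/funext => y; rewrite big_cons; case: ifP; rewrite ?add0r.
by apply: continuousD => //; case: (P i) => //; exact: cvg_cst.
Qed.

Section OpenSet.
Context {A : set E} (Ao : open A).

Lemma Ck1_continuous (F : normedModType R) (g : E -> F) x : Ck 1 A g -> A x ->
  {for x, continuous g}.
Proof. by move=> [gd _] Ax; apply/differentiable_continuous/gd. Qed.

Lemma Ck1_cst (F : normedModType R) (a : F) : Ck 1 A (fun=> a).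
Proof.
split=> [x _|v x _]; first exact: differentiable_cst.
rewrite (_ : 'D_v (fun=> a) = cst 0); first exact: cvg_cst.
by apply/funext => y; rewrite derive_cst.
Qed.

Lemma Ck1_eq (F : normedModType R) (g h : E -> F) : g =1 h -> Ck 1 A g -> Ck 1 A h.
Proof. by move=> /funext->. Qed.

Lemma Ck1D (F : normedModType R) (g h : E -> F) : Ck 1 A g -> Ck 1 A h ->
  Ck 1 A (fun x => g x + h x).
Proof.
move=> [gd gc] [hd hc]; split=> [x Ax|v x Ax].
  by apply: differentiableD; [exact: gd|exact: hd].
apply: (@continuous_on_open _ A (fun x => 'D_v g x + 'D_v h x)) => // [y Ay|].
  by rewrite (_ : (fun x => _) = g + h) // deriveD //; apply: diff_derivable;
    [exact: gd|exact: hd].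
by apply: continuousD; [exact: gc|exact: hc].
Qed.

Lemma Ck1_sum (F : normedModType R) I (r : seq I) (P : pred I) (g : I -> E -> F) :
  (forall i, Ck 1 A (g i)) -> Ck 1 A (fun x => \sum_(i <- r | P i) g i x).
Proof.
move=> gC; elim: r => [|i r IH].
  by apply: Ck1_eq (@Ck1_cst F 0) => x; rewrite big_nil.
apply: Ck1_eq (_ : Ck 1 A (fun x => (if P i then g i x else 0) +
    \sum_(i <- r | P i) g i x)) => [x|].
  by rewrite big_cons; case: ifP; rewrite ?add0r.
by apply: Ck1D; [case: (P i); [exact: gC|exact: Ck1_cst]|exact: IH].
Qed.

Lemma Ck1M (g h : E -> R) : Ck 1 A g -> Ck 1 A h -> Ck 1 A (fun x => g x * h x).
Proof.
move=> gC hC; have [gd gc] := gC; have [hd hc] := hC; split=> [x Ax|v x Ax].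
  by apply: differentiableM; [exact: gd|exact: hd].
apply: (@continuous_on_open _ A (fun x => g x * 'D_v h x + h x * 'D_v g x)) => //.
  move=> y Ay; rewrite (_ : (fun x => _) = g * h) // deriveM //;
    apply: diff_derivable; [exact: gd|exact: hd].
apply: continuousD; apply: continuousM; [exact: Ck1_continuous gC Ax|exact: hc|
  exact: Ck1_continuous hC Ax|exact: gc].
Qed.

Lemma Ck1_prod I (r : seq I) (P : pred I) (g : I -> E -> R) :
  (forall i, Ck 1 A (g i)) -> Ck 1 A (fun x => \prod_(i <- r | P i) g i x).
Proof.
move=> gC; elim: r => [|i r IH].
  by apply: Ck1_eq (@Ck1_cst R 1) => x; rewrite big_nil.
apply: Ck1_eq (_ : Ck 1 A (fun x => (if P i then g i x else 1) *
    \prod_(i <- r | P i) g i x)) => [x|].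
  by rewrite big_cons; case: ifP; rewrite ?mul1r.
by apply: Ck1M; [case: (P i); [exact: gC|exact: Ck1_cst]|exact: IH].
Qed.

Lemma Ck1V (g : E -> R) : Ck 1 A g -> (forall x, A x -> g x != 0) ->
  Ck 1 A (fun x => (g x)^-1).
Proof.
move=> gC g0; have [gd gc] := gC; split=> [x Ax|v x Ax].
  by apply: differentiableV; [exact: gd|exact: g0].
apply: (@continuous_on_open _ A (fun x => - (g x)^-1 * (g x)^-1 * 'D_v g x)) => //.
  move=> y Ay; rewrite deriveV ?g0 //; last exact/diff_derivable/gd.
  by rewrite -exprVn expr2 mulNr scaleNr; rewrite mulNr.
have gVc : {for x, continuous (fun y => (g y)^-1)}.
  by apply: continuousV; [exact: g0|exact: Ck1_continuous gC Ax].
apply: continuousM; last exact: gc.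
by apply: continuousM; [exact: continuousN|exact: gVc].
Qed.

Lemma Ck1_mxP m n (M : E -> 'M[R]_(m, n)) :
  Ck 1 A M <-> forall i j, Ck 1 A (fun x => M x i j).
Proof.
split=> [[Md Mc] i j|h].
  split=> [x Ax|v x Ax].
    apply: (@differentiable_comp _ _ _ _ M (fun N : 'M[R]_(m, n) => N i j)).
      exact: Md.
    exact: differentiable_coord.
  apply: (@continuous_on_open _ A (fun x => ('D_v M x) i j)) => // [y Ay|].
    by rewrite derive_mx ?mxE //; exact/diff_derivable/Md.
  apply: (@continuous_comp _ _ _ ('D_v M) (fun N : 'M[R]_(m, n) => N i j)).
    exact: Mc.
  exact: coord_continuous.
have ME : M = \sum_(i < m) \sum_(j < n) (fun x => M x i j *: delta_mx i j).
  apply/funext => x; rewrite fct_sumE [LHS]matrix_sum_delta.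
  by apply: eq_bigr => i _; rewrite fct_sumE.
split=> [x Ax|v x Ax].
  rewrite ME; apply: differentiable_sum => i; apply: differentiable_sum => j.
  by apply: differentiableZl; have [d _] := h i j; exact: d.
apply: (@continuous_on_open _ A (fun x => \matrix_(i, j) 'D_v (fun y => M y i j) x))
    => // [y Ay|].
  rewrite derive_mx //; apply/derivable_mxP => i j; apply: diff_derivable.
  by have [d _] := h i j; exact: d.
apply: continuous_mx => i j.
rewrite (_ : (fun y => _) = 'D_v (fun y => M y i j)).
  by have [_ c] := h i j; exact: c.
by apply/funext => y; rewrite mxE.
Qed.

Lemma Ck1_mulmx m n k (M : E -> 'M[R]_(m, n)) (N : E -> 'M[R]_(n, k)) :
  Ck 1 A M -> Ck 1 A N -> Ck 1 A (fun x => M x *m N x).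
Proof.
move=> /Ck1_mxP hM /Ck1_mxP hN; apply/Ck1_mxP => i j.
apply: (@Ck1_eq _ (fun x => \sum_l M x i l * N x l j)) => [x|].
  by rewrite mxE.
by apply: Ck1_sum => l; exact: Ck1M.
Qed.

Lemma Ck1_trmx m n (M : E -> 'M[R]_(m, n)) :
  Ck 1 A M -> Ck 1 A (fun x => (M x)^T).
Proof.
move=> /Ck1_mxP hM; apply/Ck1_mxP => i j.
by apply: (@Ck1_eq _ (fun x => M x j i)) => [x|]; rewrite ?mxE.
Qed.

Lemma Ck1_det n (M : E -> 'M[R]_n) : Ck 1 A M -> Ck 1 A (fun x => \det (M x)).
Proof.
move=> /Ck1_mxP hM; apply: Ck1_sum => s; apply: Ck1M; first exact: Ck1_cst.
by apply: Ck1_prod => i; exact: hM.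
Qed.

Lemma Ck1_eq_on (F : normedModType R) (g h : E -> F) :
  (forall x, A x -> g x = h x) -> Ck 1 A g -> Ck 1 A h.
Proof.
move=> gh [gd gc]; split=> [x Ax|v x Ax].
  by apply: differentiable_on_open gh _ => //; exact: gd.
apply: (@continuous_on_open _ A ('D_v g)) => // [y Ay|]; last exact: gc.
exact: derive_on_open gh.
Qed.

Lemma Ck1_invmx n (M : E -> 'M[R]_n) : Ck 1 A M ->
  (forall x, A x -> M x \in unitmx) -> Ck 1 A (fun x => invmx (M x)).
Proof.
move=> hM Mu; apply: (@Ck1_eq_on _ (fun x => (\det (M x))^-1 *: \adj (M x))).
  by move=> x /Mu Mx; rewrite /invmx Mx.
apply/Ck1_mxP => i j.
apply: (@Ck1_eq _ (fun x => (\det (M x))^-1 * ((-1) ^+ (j + i) *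
    \det (row' j (col' i (M x)))))) => [x|].
  by rewrite !mxE.
apply: Ck1M.
  by apply: Ck1V; [exact: Ck1_det|move=> x /Mu; rewrite unitmxE unitfE].
apply: Ck1M; first exact: Ck1_cst.
apply: Ck1_det; apply/Ck1_mxP => k l.
apply: (@Ck1_eq _ (fun x => M x (lift j k) (lift i l))) => [x|].
  by rewrite !mxE.
by have /Ck1_mxP := hM; apply.
Qed.

Lemma Ck1_comp m n (phi : 'M[R]_(m, n) -> R) (M : E -> 'M[R]_(m, n)) :
  Ck 1 setT phi -> Ck 1 A M -> Ck 1 A (phi \o M).
Proof.
move=> [pd pc] hM; have [Md Mc] := hM; split=> [x Ax|v x Ax].
  by apply: differentiable_comp; [exact: Md|exact: pd].
(* [Ck] gives the continuity of the derivative of [phi] in each fixed direction, whereas the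
   direction ['D_v M x] moves with [x]; hence the expansion over the basis matrices. *)
apply: (@continuous_on_open _ A (fun x => \sum_i \sum_j
    'D_v M x i j * 'D_(delta_mx i j) phi (M x))) => // [y Ay|].
  have Dd := Md _ Ay; rewrite [RHS]deriveE; last first.
    by apply: differentiable_comp => //; exact: pd.
  rewrite (diff_comp Dd (pd _ I)) /=.
  rewrite -(deriveE _ Dd) [X in _ = 'd phi _ X]matrix_sum_delta.
  rewrite linear_sum /=; apply: eq_bigr => i _.
  rewrite linear_sum /=; apply: eq_bigr => j _.
  by rewrite linearZ /= -(deriveE _ (pd _ I)).
apply: continuous_sum => i; apply: continuous_sum => j.
apply: continuousM; first by have /Ck1_mxP/(_ i j)[_ c] := hM;
  apply: (@continuous_on_open _ A ('D_v (fun y => M y i j))) => // [y Ay|];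
  [rewrite derive_mx ?mxE //; exact/diff_derivable/Md|exact: c].
apply: (@continuous_comp _ _ _ M ('D_(delta_mx i j) phi)); last exact: pc.
exact: Ck1_continuous hM Ax.
Qed.

End OpenSet.
End Calculus.

(** * Symmetry of mixed second derivatives *)

Section MixedDerivatives.
Context {R : realType} {E : normedModType R}.

Lemma derive_translate (f : E -> R) a x v :
  'D_v (fun y => f (y + a)) x = 'D_v f (x + a).
Proof.
rewrite /derive; have e : (fun h : R => h^-1 *: (((fun y => f (y + a)) \o shift x)
    (h *: v) - f (x + a))) =
    (fun h : R => h^-1 *: ((f \o shift (x + a)) (h *: v) - f (x + a))).
  by apply/funext => h /=; rewrite addrA.
by rewrite e.
Qed.

Lemma mvt_line (g : E -> R) x v (h : R) : (forall z, differentiable g z) ->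
  0 < h -> exists2 xi, 0 < xi < h &
    g (x + h *: v) - g x = h * 'D_v g (x + xi *: v).
Proof.
move=> gd h0; pose phi t := g (x + t *: v).
have phid (t : R) : is_derive t 1 phi ('D_v g (x + t *: v)).
  by apply: (@is_derive_comp _ _ _ (fun s : R => x + s *: v)); [exact: is_derive_line|].
have [|xi xih] := MVT h0 (fun t _ => phid t).
  apply: continuous_subspaceT => t; apply/differentiable_continuous.
  by apply/derivable1_diffP; have [] := phid t.
rewrite /phi scale0r addr0 subr0 mulrC => e.
by exists xi => //; rewrite in_itv in xih.
Qed.

(** The mean value theorem is applied twice: along [v] to the increment of [f] by [h *: w], then
    along [w] to ['D_v f]. *)
Lemma second_difference (f : E -> R) x v w (h : R) : Ck 2 setT f -> 0 < h ->
  exists xi eta, [/\ 0 < xi < h, 0 < eta < h &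
    f (x + h *: v + h *: w) - f (x + h *: v) - (f (x + h *: w) - f x)
      = h * (h * 'D_w ('D_v f) (x + xi *: v + eta *: w))].
Proof.
move=> [fd fC] h0; have {}fd z : differentiable f z by exact: fd.
have fhd z : differentiable (fun y => f (y + h *: w)) z.
  by apply: (@differentiable_comp _ _ _ _ (fun y => y + h *: w) f).
pose g z := f (z + h *: w) - f z.
have gd z : differentiable g z by exact: differentiableB.
have [xi xih gE] := mvt_line x v gd h0.
have [vd _] := fC v.
have [eta etah vE] := mvt_line (x + xi *: v) w (fun z => vd z I) h0.
exists xi, eta; split=> //; rewrite -vE; apply: etrans gE _; congr (_ * _).
rewrite deriveB; [|exact/diff_derivable|exact/diff_derivable].
by rewrite derive_translate.
Qed.

Theorem derive_swap (f : E -> R) x v w : Ck 2 setT f ->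
  'D_w ('D_v f) x = 'D_v ('D_w f) x.
Proof.
move=> fC; have [_ fC1] := fC.
have cvw : {for x, continuous ('D_w ('D_v f))} by have [_ c] := fC1 v; exact: c.
have cwv : {for x, continuous ('D_v ('D_w f))} by have [_ c] := fC1 w; exact: c.
apply/eqP/negPn/negP => ne; set d := 'D_w ('D_v f) x - 'D_v ('D_w f) x.
have d0 : 0 < `|d| / 2 by rewrite divr_gt0 // normr_gt0 subr_eq0.
have /cvgrPdist_lt/(_ _ d0) c1 := cvw; have /cvgrPdist_lt/(_ _ d0) c2 := cwv.
have [e /= e0 eE] : exists2 e : R, 0 < e & forall y, `|x - y| < e ->
    `|'D_w ('D_v f) x - 'D_w ('D_v f) y| < `|d| / 2 /\
    `|'D_v ('D_w f) x - 'D_v ('D_w f) y| < `|d| / 2.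
  have [e e0 eE] := (nbhs_ballP _ _).1 (filterI c1 c2); exists e => // y xy.
  by apply: eE; rewrite -ball_normE.
have [h h0 hE] : exists2 h : R, 0 < h & h + h * `|v| + h * `|w| = e.
  have vw0 : 0 < 1 + `|v| + `|w| by rewrite ltr_pwDl ?addr_ge0.
  exists (e / (1 + `|v| + `|w|)); first by rewrite divr_gt0.
  by rewrite -[X in X + _ + _]mulr1 -!mulrDr divfK // gt_eqF.
have small (a b : R) : 0 < a < h -> 0 < b < h ->
    `|x - (x + a *: v + b *: w)| < e.
  move=> /andP[a0 ah] /andP[b0 bh].
  rewrite -addrA opprD addrA subrr sub0r normrN.
  apply: le_lt_trans (ler_normD _ _) _; rewrite !normrZ !gtr0_norm //.
  apply: (@le_lt_trans _ _ (h * `|v| + h * `|w|)).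
    by rewrite lerD // ler_wpM2r // ltW.
  by rewrite -[X in _ < X]hE -addrA ltrDr.
have [a [b [ah bh ab]]] := second_difference x v w fC h0.
have [a' [b' [ah' bh' ab']]] := second_difference x w v fC h0.
(* Both sides times [h ^+ 2] are the same second difference, expanded in the two orders; the two
   points lie within [e] of [x]. *)
have e1 : 'D_w ('D_v f) (x + a *: v + b *: w) =
    'D_v ('D_w f) (x + b' *: v + a' *: w).
  rewrite [x + b' *: v + _]addrAC.
  apply: (mulfI (lt0r_neq0 h0)); apply: (mulfI (lt0r_neq0 h0)).
  have swap (s t y z : R) : s - t - (y - z) = s - y - (t - z) by ring.
  rewrite swap [x + h *: w + h *: v]addrAC in ab'; exact: etrans (esym ab) ab'.
have [d1 _] := eE _ (small _ _ ah bh).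
have [_ d2] := eE _ (small _ _ bh' ah').
have : `|d| < `|d|; last by rewrite ltxx.
rewrite [X in _ < X](splitr `|d|).
apply: le_lt_trans (ltrD d1 d2); rewrite -[X in _ <= _ + X]normrN e1.
by apply: le_trans (ler_normD _ _); rewrite opprB subrKA.
Qed.

End MixedDerivatives.

(** * Curves on a set, and the covariant derivative of a field at one of its zeros *)

Section Curves.
Context {R : realType}.

Lemma curve_near {E : normedModType R} (M A : set E) x v c : open A -> A x ->
  curve M x v c -> \forall t \near (0 : R), A (c t).
Proof.
move=> Ao Ax [_ c0 [cd _]].
have cc : {for (0 : R), continuous c}.
  by apply/differentiable_continuous/derivable1_diffP.
by apply: cc; rewrite c0; exact: open_nbhs_nbhs.
Qed.

(** [D] is the differential at [x] of a local extension; [D 0 = 0] removes the bracket term taken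
    along a vanishing field. *)
Lemma C1_on_tderive {E F : normedModType R} (M : set E) (phi : E -> F) x :
  C1_on M phi -> M x ->
  exists D : E -> F, D 0 = 0 /\ forall v, is_tderive M x v phi (D v).
Proof.
move=> phiC Mx; have [A [psi [Ao Ax [psid _] psiE]]] := phiC x Mx.
exists (fun v => 'D_v psi x); split; first exact: derive0.
move=> v c cv; have [cM c0 cd] := cv.
have cA := curve_near Ao Ax cv.
apply: (@near_eq_is_derive _ _ _ (psi \o c)).
  by near=> t; apply: psiE; near: t.
by rewrite -[in 'D_v psi x]c0; apply: is_derive_comp => //; rewrite c0; exact: psid.
Unshelve. all: by end_near. Qed.

(* At a zero of [xi] the torsion axiom involves only the derivative of [xi]. *)
Lemma nabla_at_zero {E : normedModType R} (S : rmanifold E) nabla x V xi a :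
  levi_civita S nabla -> pts S x -> vector_field S V -> vector_field S xi ->
  xi x = 0 -> is_tderive (pts S) x (V x) xi a ->
  vsp S x (nabla x (V x) xi - a).
Proof.
move=> lc Sx Vf xif xi0 xia; have [VC _ _] := Vf; have [_ xih _] := xif.
have [D [D0 VD]] := C1_on_tderive VC Sx.
have := nabla_torsion lc Sx Vf xif xia (VD (xi x)).
have h0 : hsp S x 0 by rewrite -xi0; exact: xih.
have n0 : nabla x 0 V = 0.
  have := nabla_linear lc (-1) Sx h0 h0 Vf; rewrite scaler0 addr0.
  by rewrite scaleN1r addNr.
by rewrite xi0 D0 n0 !subr0.
Qed.

Lemma is_derive_min0 (phi : R -> R) d : is_derive (0 : R) 1 phi d ->
  phi 0 = 0 -> (\forall t \near (0 : R), 0 <= phi t) -> d = 0.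
Proof.
move=> [phid phiE] phi0 phi_ge0; apply/eqP/negPn/negP => d0.
have : (fun h : R => h^-1 *: ((phi \o shift 0) (h *: 1) - phi 0)) @ 0^' --> d.
  by rewrite -phiE; exact: phid.
have nd : 0 < `|d| by rewrite normr_gt0.
move=> /cvgrPdist_lt/(_ _ nd); rewrite /dnbhs near_withinE => h1.
have [e /= e0 eE] := (nbhs_ballP _ _).1 (filterI h1 phi_ge0).
(* The sign of [t] is opposite to that of [d]. The quotient [q] is closer to [d] than [|d|], hence
   has the sign of [d], and [q * t = phi t] would be negative. *)
pose t := - Num.sg d * (e / 2).
have te : `|t| < e.
  by rewrite /t normrM normrN normr_sg d0 mul1r gtr0_norm ?divr_gt0 //; lra.
have t0 : t != 0 by rewrite mulf_neq0 ?oppr_eq0 ?sgr_eq0 // gt_eqF ?divr_gt0.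
have [] := eE t; first by rewrite -ball_normE /= sub0r normrN.
move=> /(_ t0); rewrite /= phi0 subr0 addr0 [t *: 1]mulr1.
set q := t^-1 * phi t => h2 pt.
have dt : d * t < 0.
  by rewrite /t mulrA mulrN mulNr oppr_lt0 [d * _]mulrC -normrEsg mulr_gt0 ?divr_gt0.
have qt : 0 <= q * t by rewrite /q mulrAC mulVf // mul1r.
have dq : 0 < d * q.
  have : `|d - q| ^+ 2 < `|d| ^+ 2 by rewrite ltr_pXn2r ?nnegrE.
  rewrite !real_normK ?num_real // => ?; nra.
have : 0 <= (d * d) * (q * t) by rewrite mulr_ge0 // -expr2 sqr_ge0.
by rewrite mulrACA => ?; nra.
Qed.

Lemma open_unitmx {E : normedModType R} n (M : E -> 'M[R]_n) :
  Ck 1 setT M -> open [set x | M x \in unitmx].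
Proof.
move=> MC; have dC := Ck1_det (@openT E) MC.
rewrite openE => x /= ux.
have : (fun y => \det (M y)) @ x --> \det (M x) by exact: Ck1_continuous dC I.
have dx : \det (M x) != 0 by rewrite -unitfE -unitmxE.
move=> /cvgr_neq0/(_ dx); apply: filterS => y.
by rewrite /= unitmxE unitfE.
Qed.

End Curves.

(** * Tangent space of the positive semidefinite matrices of fixed rank *)

Section EmbeddedTangent.
Context {R : realType}.

Lemma psd_congr n m (X : 'M[R]_n) (B : 'M[R]_(m, n)) : psd X -> psd (B *m X *m B^T).
Proof.
move=> [Xs Xp]; split=> [|v]; first exact: sym_congr.
have := Xp (B^T *m v); rewrite trmx_mul trmxK !mulmxA.
by [].
Qed.

Lemma psd_gram p r (Z : 'M[R]_(p, r)) : psd (Z *m Z^T).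
Proof.
have := @psd_congr r p 1%:M Z; rewrite mulmx1; apply.
split=> [|v]; first by rewrite /sym trmx1.
rewrite mulmx1 -[_ 0 0](_ : frob v v = _) ?frob_ge0 //.
by rewrite /frob /mxtrace big_ord1.
Qed.

Lemma psd_rank_gram p r (Z : 'M[R]_(p, r)) :
  \rank Z = r -> psd_rank p r (Z *m Z^T).
Proof.
move=> rZ; split; first exact: psd_gram.
have Zu := rank_gram_unit rZ.
have e : \rank (Z *m (Z^T *m Z)) = r by rewrite mxrankMfree // row_free_unit.
have := mxrankM_maxl (Z *m Z^T) Z; rewrite -mulmxA e => le1.
by apply/eqP; rewrite eqn_leq le1 (leq_trans (mxrankM_maxl _ _)) ?rZ.
Qed.

Lemma col_basis_gram p r (Z U : 'M[R]_(p, r)) : \rank Z = r ->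
  (U^T :=: Z *m Z^T)%MS <-> (U^T :=: Z^T)%MS.
Proof.
move=> rZ; have [_ rX] := psd_rank_gram rZ.
have e : (Z *m Z^T :=: Z^T)%MS.
  apply/eqmxP; rewrite -(geq_leqif (mxrank_leqif_eq (submxMl _ _))).
  by rewrite mxrank_tr rZ rX.
by split=> h; apply: eqmx_trans h _ => //; exact: eqmx_sym.
Qed.

Section Range.
Context {p r : nat} {X : 'M[R]_p} (Xr : psd_rank p r X).
Context {U : 'M[R]_(p, r)} (UU : orthonormal_cols U) (UX : (U^T :=: X)%MS).
Let N := 1%:M - U *m U^T.

Lemma range_proj : X *m U *m U^T = X /\ U *m U^T *m X = X.
Proof.
have [[Xs _] _] := Xr.
have XP : X *m U *m U^T = X by apply: proj_sub => //; rewrite UX.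
by split=> //; rewrite -{2}Xs -{2}XP !trmx_mul trmxK Xs mulmxA.
Qed.

Lemma coproj_sym : N^T = N.
Proof. by rewrite /N raddfB /= trmx1 trmx_mul trmxK. Qed.

Lemma coproj0 : N *m X = 0 /\ X *m N = 0.
Proof.
have [XP PX] := range_proj.
by rewrite /N mulmxBl mulmxBr mul1mx mulmx1 PX mulmxA XP subrr.
Qed.

(** The witness is the pseudo-inverse of [X]: the inverse of the compression [U^T X U], carried back
    to the range. *)
Lemma range_pinv : exists Xi : 'M[R]_p, Xi *m X = U *m U^T.
Proof.
have [XP PX] := range_proj; have [_ rX] := Xr.
have Cu : U^T *m X *m U \in unitmx.
  rewrite -row_full_unit /row_full eqn_leq rank_leq_col /=.
  have e : U *m (U^T *m X *m U) *m U^T = X by rewrite !mulmxA PX XP.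
  by rewrite -{1}rX -{1}e (leq_trans (mxrankM_maxl _ _)) // mxrankM_maxr.
have : U^T *m X = (U^T *m X *m U) *m U^T by rewrite -{1}XP !mulmxA.
move: (U^T *m X *m U) Cu => C Cu e; exists (U *m invmx C *m U^T).
by rewrite -(mulmxA _ U^T) e mulmxA mulmxKV.
Qed.

(* The velocity at [0] of [t |-> (1 + t B) X (1 + t B)^T]. *)
Lemma curve_tangent (B : 'M[R]_p) :
  tangent_space (psd_rank p r) X (B *m X + X *m B^T).
Proof.
have [Xp rX] := Xr.
pose M (t : R) := 1%:M + t *: B.
have MC : Ck 1 setT M.
  apply/Ck1_mxP; first exact: openT.
  move=> i j; apply: (@Ck1_eq _ _ _ _ (fun t : R => 1%:M i j + t * B i j)) => [t|].
    by rewrite !mxE.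
  apply: Ck1D; [exact: openT|exact: Ck1_cst|].
  apply: Ck1M; [exact: openT| |exact: Ck1_cst].
  split=> [t _|v t _]; first exact: ex_diff.
  rewrite (_ : 'D_v _ = cst v); first exact: cvg_cst.
  by apply/funext => s; rewrite derive_id.
exists (fun t => M t *m X *m (M t)^T); split.
(* Near [0] the matrix [M t] is invertible, and congruence by it preserves both rank and
   positivity. *)
- have Mo := open_unitmx MC.
  have M0 : M 0 \in unitmx by rewrite /M scale0r addr0 unitmx1.
  have : \forall t \near (0 : R), M t \in unitmx by exact: open_nbhs_nbhs.
  apply: filterS => t Mt; split; first exact: psd_congr.
  rewrite mxrankMfree ?row_free_unit ?unitmx_tr //.
  by rewrite -mxrank_tr trmx_mul mxrankMfree ?mxrank_tr // row_free_unit unitmx_tr.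
- by rewrite /M scale0r addr0 trmx1 mulmx1 mul1mx.
- have Md := is_derive_line (1%:M : 'M[R]_p) B 0.
  have Xd := is_derive_cst X (0 : R) 1.
  apply: is_derive_ext (is_derive_mulmx (is_derive_mulmx Md Xd) (is_derive_trmx Md)).
    by [].
  by rewrite !scale0r !addr0 !mulmx0 !addr0 trmx1 mulmx1 mul1mx.
Qed.

Lemma sym_quadratic0 n (S : 'M[R]_n) : sym S ->
  (forall u : 'rV[R]_n, (u *m S *m u^T) 0 0 = 0) -> S = 0.
Proof.
move=> Ss S0; apply/matrixP => i j; rewrite mxE.
have h (u v : 'rV[R]_n) : (u *m S *m v^T) 0 0 = 0.
  have vu : (v *m S *m u^T) 0 0 = (u *m S *m v^T) 0 0.
    by rewrite -[v *m _ *m _]trmxK mxE !trmx_mul trmxK Ss mulmxA.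
  have ad (A B : 'M[R]_1) : (A + B) 0 0 = A 0 0 + B 0 0 by rewrite mxE.
  have := S0 (u + v); rewrite raddfD /= mulmxDr !mulmxDl !ad !S0 vu.
  by rewrite add0r addr0 => ?; lra.
have := h (delta_mx 0 i) (delta_mx 0 j).
by rewrite trmx_delta -rowE -colE !mxE.
Qed.

Lemma coproj_factor (xi : 'M[R]_p) : xi^T = xi -> N *m xi *m N = 0 ->
  exists B : 'M[R]_p, xi = B *m X + X *m B^T.
Proof.
move=> xis xiN.
have [Xi XiX] := range_pinv.
set P := U *m U^T in XiX; have Ps : P^T = P by rewrite /P trmx_mul trmxK.
move: xiN; rewrite /N -/P; clearbody P => xiN.
(* Then [B X = xi P - P xi P / 2], which added to its transpose gives [xi P + P xi - P xi P]; this
   is [xi] because [N xi N = 0]. The half keeps the block [P xi P] from being counted twice. *)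
pose B := (xi - 2^-1 *: (P *m xi)) *m Xi.
exists B.
have [[Xs _] _] := Xr.
have -> : X *m B^T = (B *m X)^T by rewrite [RHS]trmx_mul Xs.
have -> : B *m X = xi *m P - 2^-1 *: (P *m xi *m P).
  by rewrite /B -mulmxA XiX mulmxBl -scalemxAl.
rewrite raddfB /= [(_ *: _)^T]linearZ /= !trmx_mul xis Ps !mulmxA.
move: xiN; rewrite mulmxBl mul1mx mulmxBr mulmx1 mulmxBl.
move/eqP; rewrite subr_eq0 subr_eq => /eqP h.
rewrite {1}h; move: (P *m xi) (xi *m P) (P *m xi *m P) => a b c'.
apply/matrixP => i j; rewrite !mxE; lra.
Qed.

(* If [u] is in the kernel of [X], then [u c(t) u^T >= 0] vanishes at [t = 0] for
   every curve [c] through [X], so its derivative vanishes there as well. *)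
Lemma tangent_psd_rankP (xi : 'M[R]_p) :
  tangent_space (psd_rank p r) X xi <-> xi^T = xi /\ N *m xi *m N = 0.
Proof.
have [NX XN] := coproj0; split.
  move=> [c [cM c0 cd]].
  have xis : xi^T = xi.
    apply: (is_derive_unique (is_derive_trmx cd)).
    apply: (near_eq_is_derive _ cd).
    by near=> t; have [[cs _] _] : psd_rank p r (c t) by near: t.
  split=> //; apply: sym_quadratic0 => [|u].
    by rewrite -{2}coproj_sym; exact: sym_congr.
  pose phi t := ((u *m N) *m c t *m (u *m N)^T) 0 0.
  have phid : is_derive (0 : R) 1 phi (((u *m N) *m xi *m (u *m N)^T) 0 0).
    have ud := is_derive_cst (u *m N) (0 : R) 1.
    have utd := is_derive_cst (u *m N)^T (0 : R) 1.
    have := is_derive_mulmx (is_derive_mulmx ud cd) utd.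
    by rewrite mul0mx mulmx0 add0r addr0 => /is_derive_mxP/(_ 0 0).
  have := is_derive_min0 phid; rewrite trmx_mul coproj_sym !mulmxA; apply.
    by rewrite /phi c0 -(mulmxA u) NX mulmx0 mul0mx mxE.
  near=> t; have [[_ cp] _] : psd_rank p r (c t) by near: t.
  by have := cp (u *m N)^T; rewrite trmxK.
move=> [xis xiN]; have [B ->] := coproj_factor xis xiN; exact: curve_tangent.
Unshelve. all: by end_near. Qed.

End Range.

Lemma tangent_Lmap p r (Y xi : 'M[R]_(p, r)) : \rank Y = r ->
  tangent_space (psd_rank p r) (Y *m Y^T) (Lmap Y xi).
Proof.
move=> rY; have Yr := psd_rank_gram rY.
have Gu := rank_gram_unit rY.
(* Chosen so that [B Y = xi], which turns [B X + X B^T] into [Lmap Y xi]. *)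
pose B := xi *m invmx (Y^T *m Y) *m Y^T.
have -> : Lmap Y xi = B *m (Y *m Y^T) + (Y *m Y^T) *m B^T.
  have BY : B *m (Y *m Y^T) = xi *m Y^T.
    by rewrite /B !mulmxA -(mulmxA _ Y^T) mulmxKV.
  have YB : Y *m Y^T *m B^T = (B *m (Y *m Y^T))^T by rewrite !trmx_mul trmxK.
  by rewrite YB BY trmx_mul trmxK /Lmap addrC.
exact: curve_tangent.
Qed.

Lemma tangent_LmapP p r (Y : 'M[R]_(p, r)) (xi : 'M[R]_p) : \rank Y = r ->
  tangent_space (psd_rank p r) (Y *m Y^T) xi <-> exists eta, xi = Lmap Y eta.
Proof.
move=> rY; split=> [xT|[eta ->]]; last exact: tangent_Lmap.
have Yr := psd_rank_gram rY; have [_ rX] := Yr.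
have [U UU UX] := orthonormal_basis rX.
have [xs xN] := (tangent_psd_rankP Yr UU UX xi).1 xT.
have [B ->] := coproj_factor Yr UU UX xs xN.
exists (B *m Y); rewrite /Lmap trmx_mul addrC !mulmxA //.
Qed.

End EmbeddedTangent.

(** * Euclidean gradient and Riemannian gradient on the embedded manifold *)

Section Gradients.
Context {R : realType}.

Definition nab m n (f : 'M[R]_(m, n) -> R) (X : 'M[R]_(m, n)) : 'M[R]_(m, n) :=
  \matrix_(i, j) 'D_(delta_mx i j) f X.

Lemma derive_frob m n (f : 'M[R]_(m, n) -> R) X v : differentiable f X ->
  'D_v f X = frob (nab f X) v.
Proof.
move=> fd; rewrite deriveE // frobE [X in 'd f _ X]matrix_sum_delta.
rewrite linear_sum; apply: eq_bigr => i _; rewrite linear_sum.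
apply: eq_bigr => j _; rewrite linearZ /= -deriveE // mxE mulrC //.
Qed.

Definition C2_sym p (f : 'M[R]_p -> R) : Prop :=
  Ck 2 setT f /\ forall X, f X = f X^T.

Lemma C2_differentiable p (f : 'M[R]_p -> R) X : C2_sym f -> differentiable f X.
Proof. by move=> [[fd _] _]; exact: fd. Qed.

(** Transposition exchanges the lines through [X] directed by [delta_mx i j] and [delta_mx j i], and
    leaves [f] unchanged. *)
Lemma nab_sym p (f : 'M[R]_p -> R) X : C2_sym f -> X^T = X -> sym (nab f X).
Proof.
move=> [_ fT] Xs; apply/matrixP => i j; rewrite !mxE /derive.
have e : (fun h : R => h^-1 *: ((f \o shift X) (h *: delta_mx j i) - f X)) =
    (fun h : R => h^-1 *: ((f \o shift X) (h *: delta_mx i j) - f X)).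
  apply/funext => h /=; congr (_ * (_ - _)).
  by rewrite fT linearD linearZ /= trmx_delta Xs.
by rewrite e.
Qed.

Lemma nab_C1 p (f : 'M[R]_p -> R) : C2_sym f -> Ck 1 setT (nab f).
Proof.
move=> [[_ fC] _]; apply/Ck1_mxP; first exact: openT.
move=> i j; apply: (@Ck1_eq _ _ _ _ ('D_(delta_mx i j) f)) => [X|].
  by rewrite mxE.
exact: fC.
Qed.

Lemma derive_frob_cst m n (v w X : 'M[R]_(m, n)) : 'D_w (frob v) X = frob v w.
Proof.
apply/lim_near_cst => //=; near=> h.
have h0 : h != 0 by near: h; exact: nbhs_dnbhs_neq.
by rewrite frobC frob_linear (frobC X) addrK (frobC w) [_ *: _]mulKf.
Unshelve. all: by end_near. Qed.

Lemma Ck1_id m n (A : set 'M[R]_(m, n)) : Ck 1 A (fun X : 'M[R]_(m, n) => X).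
Proof.
split=> [X _|v X _]; first exact: ex_diff.
rewrite (_ : 'D_v _ = cst v); first exact: cst_continuous.
by apply/funext => Z; rewrite derive_id.
Qed.

(** Linear functions serve as auxiliary objectives: their Riemannian gradients are vector fields
    with a prescribed value at a point. *)
Lemma frob_C2_sym p (v : 'M[R]_p) : v^T = v ->
  C2_sym (frob v) /\ forall X, nab (frob v) X = v.
Proof.
move=> vs; split; last first.
  move=> X; apply/matrixP => i j; rewrite mxE derive_frob_cst frobE.
  rewrite (bigD1 i) //= (bigD1 j) //= mxE !eqxx mulr1 !big1 ?addr0 //.
    by move=> k ki; rewrite big1 // => l _; rewrite mxE (negbTE ki) mulr0.
  by move=> k kj; rewrite mxE (negbTE kj) andbF mulr0.
split; last by move=> X; rewrite -[in RHS]vs frob_tr.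
split=> [X _|w].
  suff [d _] : Ck 1 setT (frob v) by exact: d.
  apply: (@Ck1_eq _ _ _ _ (fun X : 'M[R]_p => \sum_i \sum_j v i j * X i j)) => [Z|].
    by rewrite frobE.
  apply: Ck1_sum => [|i]; first exact: openT.
  apply: Ck1_sum => [|j]; first exact: openT.
  apply: Ck1M; [exact: openT|exact: Ck1_cst|].
  by have /(Ck1_mxP (@openT _)) := @Ck1_id p p setT; apply.
rewrite (_ : 'D_w _ = fun=> frob v w); first exact: Ck1_cst.
by apply/funext => Z; rewrite derive_frob_cst.
Qed.

Section Embedded.
Context {p r : nat} {f : 'M[R]_p -> R} (fC : C2_sym f).

(** For symmetric [G], the orthogonal projection onto the tangent space at a point whose column
    space is spanned by [U]. *)
Definition ptan (U : 'M[R]_(p, r)) (G : 'M[R]_p) : 'M[R]_p :=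
  G - (1%:M - U *m U^T) *m G *m (1%:M - U *m U^T).

Section Point.
Context {X : 'M[R]_p} (Xr : psd_rank p r X).
Context {U : 'M[R]_(p, r)} (UU : orthonormal_cols U) (UX : (U^T :=: X)%MS).

Lemma coproj_idem : (1%:M - U *m U^T) *m (1%:M - U *m U^T) = 1%:M - U *m U^T.
Proof.
have PP : U *m U^T *m (U *m U^T) = U *m U^T.
  by rewrite -!mulmxA (mulmxA U^T) UU mul1mx.
by rewrite mulmxBl mul1mx mulmxBr mulmx1 PP subrr subr0.
Qed.

Lemma ptan_tangent G : sym G -> tangent_space (psd_rank p r) X (ptan U G).
Proof.
move=> Gs; apply/(tangent_psd_rankP Xr UU UX); split.
  rewrite /ptan raddfB /= Gs; congr (_ - _).
  have := @coproj_sym R p r U; move: (1%:M - _) => N Ns.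
  by rewrite !trmx_mul Ns Gs mulmxA.
rewrite /ptan; have := coproj_idem; move: (1%:M - _) => N NN.
by rewrite mulmxBr mulmxBl !mulmxA NN -!mulmxA NN subrr.
Qed.

Lemma frob_ptan G xi : tangent_space (psd_rank p r) X xi ->
  frob (ptan U G) xi = frob G xi.
Proof.
move=> /(tangent_psd_rankP Xr UU UX)[_ h]; rewrite /frob /ptan.
have Ns := @coproj_sym R p r U; move: (1%:M - _) h Ns => N h Ns.
rewrite raddfB /= mulmxBl raddfB /= !trmx_mul Ns.
suff -> : \tr (N *m (G^T *m N) *m xi) = 0 by rewrite subr0.
by rewrite -!mulmxA mxtrace_mulC -!mulmxA (mulmxA N) h mulmx0 mxtrace0.
Qed.

Lemma ptan_id xi : tangent_space (psd_rank p r) X xi -> ptan U xi = xi.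
Proof.
by move=> /(tangent_psd_rankP Xr UU UX)[_ h]; rewrite /ptan h subr0.
Qed.

Lemma tangent_linear k xi eta : tangent_space (psd_rank p r) X xi ->
  tangent_space (psd_rank p r) X eta ->
  tangent_space (psd_rank p r) X (k *: xi + eta).
Proof.
move=> /(tangent_psd_rankP Xr UU UX)[xs xN] /(tangent_psd_rankP Xr UU UX)[es eN].
apply/(tangent_psd_rankP Xr UU UX); split.
  by rewrite linearP /= xs es.
move: (1%:M - _) xN eN => N xN eN.
by rewrite mulmxDr mulmxDl -scalemxAr -scalemxAl xN eN scaler0 addr0.
Qed.

Lemma is_rgrad_embedded : is_rgrad (embedded p r) f X (ptan U (nab f X)).
Proof.
have [[Xs _] _] := Xr; split; first exact/ptan_tangent/nab_sym.
move=> v vT c cv; rewrite /= -/(frob _ _) frob_ptan // -derive_frob; last first.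
  exact: C2_differentiable.
have [_ c0 cd] := cv; rewrite -[in 'D_v f X]c0.
by apply: is_derive_comp => //; exact: C2_differentiable.
Qed.

Lemma rgrad_embedded : rgrad (embedded p r) f X = ptan U (nab f X).
Proof.
apply: xget_unique; first exact: is_rgrad_embedded.
move=> g [gT gd]; have [gT' gd'] := is_rgrad_embedded.
set g' := ptan U _ in gT' gd' *.
(* The difference of two candidates is itself tangent; testing both along it shows that its norm is
   zero. *)
have vT : tangent_space (psd_rank p r) X (g - g').
  by rewrite addrC -scaleN1r; exact: tangent_linear.
have [c cv] := vT.
have := is_derive_unique (gd _ vT c cv) (gd' _ vT c cv); rewrite /= -!/(frob _ _).
move=> e; apply/eqP; rewrite -subr_eq0; apply/eqP/frob_eq0.
by rewrite (ipB (@frob_inner_product R p p)) e subrr.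
Qed.

End Point.
End Embedded.
End Gradients.

(** * Gradients as C^1 equivariant vector fields on both manifolds *)

Section Fields.
Context {R : realType}.

Lemma Ck1_sub {E F : normedModType R} (A B : set E) (g : E -> F) :
  A `<=` B -> Ck 1 B g -> Ck 1 A g.
Proof.
by move=> AB [gd gc]; split=> [x /AB|v x /AB]; [exact: gd|exact: gc].
Qed.

Lemma Ck1B_mx {E : normedModType R} (A : set E) (Ao : open A) m n
    (M N : E -> 'M[R]_(m, n)) :
  Ck 1 A M -> Ck 1 A N -> Ck 1 A (fun x => M x - N x).
Proof.
move=> MC /(Ck1_mxP Ao) NC; apply: (Ck1D Ao MC); apply/(Ck1_mxP Ao) => i j.
apply: (@Ck1_eq _ _ _ _ (fun x => -1 * N x i j)) => [x|].
  by rewrite mxE mulN1r.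
exact: (Ck1M Ao (Ck1_cst _) (NC i j)).
Qed.

(** The left side depends smoothly on [Z], while an orthonormal basis [U] is only chosen point by
    point; this is how the projector becomes a C^1 map. *)
Lemma proj_eq p r (Z U : 'M[R]_(p, r)) : \rank Z = r -> orthonormal_cols U ->
  (Z^T <= U^T)%MS -> Z *m invmx (Z^T *m Z) *m Z^T = U *m U^T.
Proof.
move=> rZ UU ZU; have Gu := rank_gram_unit rZ.
have UZ : (U^T <= Z^T)%MS.
  have /leqifP := mxrank_leqif_sup ZU; case: ifP => // _.
  by rewrite !mxrank_tr rZ (orthonormal_cols_rank UU) ltnn.
have PZ : U *m U^T *m Z = Z.
  have := proj_sub UU ZU; move/(congr1 trmx).
  by rewrite !trmx_mul !trmxK mulmxA.
have /submxP[D UD] := UZ.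
have {}UD : U = Z *m D^T by rewrite -[U]trmxK UD trmx_mul trmxK.
set P := Z *m _ *m Z^T.
have PU : P *m U = U by rewrite {1}UD /P -!mulmxA (mulmxA Z^T) mulKmx // -UD.
have Ps : P^T = P.
  by rewrite /P !trmx_mul trmxK trmx_inv trmx_mul trmxK mulmxA.
have UP : U *m U^T *m P = P by rewrite /P !mulmxA PZ.
clearbody P; by rewrite -Ps -UP trmx_mul Ps trmx_mul trmxK mulmxA PU.
Qed.

Section Embedded.
Context {p r : nat} {f : 'M[R]_p -> R} (fC : C2_sym f).

Lemma psd_rank_basis (X : 'M[R]_p) : psd_rank p r X ->
  exists2 U : 'M[R]_(p, r), orthonormal_cols U & (U^T :=: X)%MS.
Proof. by move=> [_ rX]; exact: orthonormal_basis rX. Qed.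

(* Near [X], the range of [M] is spanned by the columns of [M U] if that of [X]
   is spanned by the columns of [U]; this gives a local formula for the gradient. *)
Lemma rgrad_embedded_C1 : C1_on (psd_rank p r) (rgrad (embedded p r) f).
Proof.
move=> X Xr; have [U UU UX] := psd_rank_basis Xr; have [[Xs _] rX] := Xr.
pose Z (M : 'M[R]_p) := M *m U.
pose gram M := (Z M)^T *m Z M.
have oT : open (setT : set 'M[R]_p) by exact: openT.
have ZC (A : set 'M[R]_p) (Ao : open A) : Ck 1 A Z.
  exact: (Ck1_mulmx Ao (@Ck1_id _ _ _ _) (Ck1_cst _)).
have gramC (A : set 'M[R]_p) (Ao : open A) : Ck 1 A gram.
  exact: (Ck1_mulmx Ao (Ck1_trmx Ao (ZC _ Ao)) (ZC _ Ao)).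
pose A := [set M | gram M \in unitmx].
have Ao : open A by apply: open_unitmx; exact: gramC.
pose Pi M := Z M *m invmx (gram M) *m (Z M)^T.
pose psi M := nab f M - (1%:M - Pi M) *m nab f M *m (1%:M - Pi M).
have rZ M : A M -> \rank (Z M) = r.
  move=> Mu; apply/eqP; rewrite eqn_leq rank_leq_col /=.
  by have := mxrankM_maxr (Z M)^T (Z M); rewrite mxrank_unit.
exists A, psi; split.
- exact: Ao.
- rewrite /A /=; apply: rank_gram_unit.
  apply/eqP; rewrite eqn_leq rank_leq_col /=.
  have := mxrankM_maxl (Z X) U^T.
  by rewrite /Z (proj_sub UU) ?UX // rX.
- have PiC : Ck 1 A (fun M => 1%:M - Pi M).
    apply: (Ck1B_mx Ao (Ck1_cst _)).
    apply: (Ck1_mulmx Ao _ (Ck1_trmx Ao (ZC _ Ao))).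
    exact: (Ck1_mulmx Ao (ZC _ Ao) (Ck1_invmx Ao (gramC _ Ao) (fun M AM => AM))).
  have nC : Ck 1 A (nab f) by apply: Ck1_sub (nab_C1 fC).
  exact: (Ck1B_mx Ao nC (Ck1_mulmx Ao (Ck1_mulmx Ao PiC nC) PiC)).
- move=> M AM Mr; have [V VV VM] := psd_rank_basis Mr.
  rewrite (rgrad_embedded fC Mr VV VM) /ptan /psi /Pi (proj_eq (rZ _ AM) VV) //.
  have [[Ms _] _] := Mr.
  by rewrite VM /Z trmx_mul Ms submxMl.
Qed.

Lemma rgrad_embedded_field :
  vector_field (embedded p r) (rgrad (embedded p r) f).
Proof.
split=> [|X Xr|a X /= -> //]; first exact: rgrad_embedded_C1.
have [U UU UX] := psd_rank_basis Xr; have [[Xs _] _] := Xr.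
rewrite (rgrad_embedded fC Xr UU UX) /=.
by apply: ptan_tangent => //; exact: nab_sym.
Qed.

End Embedded.

Section Quotient.
Context {p r : nat} {W : 'M[R]_(p, r) -> 'M[R]_r}.
Hypothesis W_spd : forall Y, full_col_rank p r Y -> spd (W Y).
Hypothesis W_C1 : Ck 1 (full_col_rank p r) W.
Hypothesis W_inv : forall (Y : 'M[R]_(p, r)) (O : 'M[R]_r),
  full_col_rank p r Y -> orthonormal_cols O -> W Y = O *m W (Y *m O) *m O^T.
Context {f : 'M[R]_p -> R} (fC : C2_sym f).
Let h (Z : 'M[R]_(p, r)) := f (Z *m Z^T).

Lemma full_col_rankE :
  full_col_rank p r = [set Z : 'M[R]_(p, r) | Z^T *m Z \in unitmx].
Proof.
apply/seteqP; split=> Z /=; first exact: rank_gram_unit.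
move=> Zu; apply/eqP; rewrite eqn_leq rank_leq_col /=.
by have := mxrankM_maxr Z^T Z; rewrite mxrank_unit.
Qed.

Lemma open_full_col_rank : open (full_col_rank p r : set 'M[R]_(p, r)).
Proof.
rewrite full_col_rankE; apply: open_unitmx.
have idC := @Ck1_id R p r setT.
exact: (Ck1_mulmx (@openT _) (Ck1_trmx (@openT _) idC) idC).
Qed.

Lemma curve_line (Y theta : 'M[R]_(p, r)) : full_col_rank p r Y ->
  curve (full_col_rank p r) Y theta (fun t => Y + t *: theta).
Proof.
move=> Yf; have ld := is_derive_line Y theta 0; split=> //; last first.
  by rewrite scale0r addr0.
have [/derivable1_diffP/differentiable_continuous lc _] := ld.
apply: lc; rewrite scale0r addr0; apply: open_nbhs_nbhs; split=> //.
exact: open_full_col_rank.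
Qed.

(** [Lmap Y] is the differential of [Z |-> Z Z^T] at [Y]; this carries derivatives from one geometry
    to the other. *)
Lemma gram_curve (Y theta : 'M[R]_(p, r)) c :
  curve (full_col_rank p r) Y theta c ->
  curve (psd_rank p r) (Y *m Y^T) (Lmap Y theta) (fun t => c t *m (c t)^T).
Proof.
move=> [cf c0 cd]; split; last 2 first.
- by rewrite c0.
- have := is_derive_mulmx cd (is_derive_trmx cd); rewrite c0 addrC.
  by apply: is_derive_ext.
by apply: filterS cf => t; exact: psd_rank_gram.
Qed.

Definition quotient_grad (Z : 'M[R]_(p, r)) : 'M[R]_(p, r) :=
  2 *: (nab f (Z *m Z^T) *m Z *m invmx (W Z)).

Lemma nab_gram_sym (Z : 'M[R]_(p, r)) : sym (nab f (Z *m Z^T)).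
Proof. by apply: nab_sym => //; rewrite trmx_mul trmxK. Qed.

(** On symmetric matrices the adjoint of [Lmap Y] is [S |-> 2 S Y], which moves pairings from the
    embedded side to the total space. *)
Lemma frob_Lmap (S : 'M[R]_p) (Y theta : 'M[R]_(p, r)) : sym S ->
  frob S (Lmap Y theta) = 2 * frob (S *m Y) theta.
Proof.
move=> Ss; rewrite /Lmap frobC (ipD (@frob_inner_product R p p)).
have -> : frob (theta *m Y^T) S = frob (Y *m theta^T) S.
  by rewrite -frob_tr trmx_mul trmxK Ss.
suff -> : frob (Y *m theta^T) S = frob (S *m Y) theta by ring.
by rewrite /frob !trmx_mul trmxK Ss -mulmxA mxtrace_mulC.
Qed.

(** The candidate is horizontal because [Z^T] times it times [W Z] is [2 Z^T (nab f) Z], a symmetric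
    matrix; in the metric the weight cancels its inverse. *)
Lemma is_rgrad_quotient Z : full_col_rank p r Z ->
  is_rgrad (quotient W) h Z (quotient_grad Z).
Proof.
move=> Zf; have Wp := W_spd Zf; have [Ws _] := Wp; have Wu := spd_unit Wp.
have Gs := nab_gram_sym Z; split.
  apply/(horizontalP _ _ Zf); rewrite /quotient_grad.
  rewrite -scalemxAr -scalemxAl !mulmxA mulmxKV // /sym linearZ /=.
  by rewrite !trmx_mul trmxK Gs mulmxA.
move=> v _ c cv; have [_ /= c0 _] := cv.
have [_ c0' cd'] := gram_curve cv.
have e : 2 * frob (nab f (Z *m Z^T) *m Z) v = met (quotient W) Z (quotient_grad Z) v.
  rewrite /= /quotient_grad linearZ /= -scalemxAr -scalemxAl linearZ /=.
  congr (_ * _); rewrite /frob [in RHS]trmx_mul mulmxA trmx_inv Ws.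
  by rewrite mulmxV // mul1mx.
have := is_derive_comp cd' (C2_differentiable _ fC).
rewrite c0 (derive_frob _ (C2_differentiable _ fC)) frob_Lmap // e.
exact: is_derive_ext.
Qed.

Lemma met_quotient_eq0 Z v : full_col_rank p r Z ->
  met (quotient W) Z v v = 0 -> v = 0.
Proof.
move=> /W_spd/spd_factor[C Cu WE] /=; rewrite WE => e.
have : frob (v *m C) (v *m C) = 0.
  by rewrite -e /frob trmx_mul -!mulmxA [RHS]mxtrace_mulC !mulmxA mxtrace_mulC !mulmxA.
by move/frob_eq0 => vC; rewrite -(mulmxK Cu v) vC mul0mx.
Qed.

Lemma rgrad_quotient Z : full_col_rank p r Z ->
  rgrad (quotient W) h Z = quotient_grad Z.
Proof.
move=> Zf; apply: xget_unique; first exact: is_rgrad_quotient.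
have [g'H g'd] := is_rgrad_quotient Zf.
move=> g [gH gd]; set g' := quotient_grad Z in g'H g'd *.
have vH : horizontal W Z (g - g').
  move: gH g'H => /= /(horizontalP _ _ Zf) gs /(horizontalP _ _ Zf) gs'.
  apply/(horizontalP _ _ Zf); rewrite mulmxBr mulmxBl /sym raddfB /=.
  by rewrite gs gs'.
have := is_derive_unique (gd _ vH _ (curve_line _ Zf)) (g'd _ vH _ (curve_line _ Zf)).
move=> /= e; apply/eqP; rewrite -subr_eq0; apply/eqP/(met_quotient_eq0 Zf) => /=.
have -> : (g - g')^T = g^T - g'^T by rewrite raddfB.
by rewrite [W Z *m _]mulmxBr mulmxBl raddfB /= e subrr.
Qed.

Lemma rgrad_quotient_field : vector_field (quotient W) (rgrad (quotient W) h).
Proof.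
have Fo := open_full_col_rank; split.
- move=> Z Zf; exists (full_col_rank p r), quotient_grad.
  split; [exact: Fo|exact: Zf| |]; last first.
    by move=> M Mf _; rewrite rgrad_quotient.
  apply: (@Ck1_eq_on _ _ _ Fo _ (fun Z => (2%:M : 'M[R]_p) *m
    (nab f (Z *m Z^T) *m Z *m invmx (W Z)))).
    by move=> M _; rewrite mul_scalar_mx.
  have idC := @Ck1_id R p r (full_col_rank p r).
  have gC := Ck1_mulmx Fo idC (Ck1_trmx Fo idC).
  have nC : Ck 1 (full_col_rank p r) (fun Z : 'M[R]_(p, r) => nab f (Z *m Z^T)).
    apply/(Ck1_mxP Fo) => i j.
    have /(Ck1_mxP (@openT _))/(_ i j) nij := nab_C1 fC.
    exact: (Ck1_comp Fo nij gC).
  have WC := Ck1_invmx Fo W_C1 (fun M Mf => spd_unit (W_spd Mf)).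
  exact: (Ck1_mulmx Fo (Ck1_cst _) (Ck1_mulmx Fo (Ck1_mulmx Fo nC idC) WC)).
- by move=> Z Zf; rewrite rgrad_quotient //; have [] := is_rgrad_quotient Zf.
- move=> a Z [Q QQ ->] Zf.
  have QQ' : Q *m Q^T = 1%:M by exact: mulmx1C.
  have Qu : Q \in unitmx by case: (mulmx1_unit QQ').
  have ZQf : full_col_rank p r (Z *m Q).
    rewrite full_col_rankE /= trmx_mul -mulmxA (mulmxA Z^T) !unitmx_mul Qu.
    by rewrite unitmx_tr Qu rank_gram_unit.
  have e : Z *m Q *m (Z *m Q)^T = Z *m Z^T.
    by rewrite trmx_mul mulmxA -(mulmxA Z) QQ' mulmx1.
  rewrite !rgrad_quotient // /quotient_grad e.
  rewrite -scalemxAl; congr (_ *: _); rewrite -!mulmxA; congr (_ *m (_ *m _)).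
  (* The invariance of the weight gives [Q W(Z Q)^-1 = W(Z)^-1 Q], which is equivariance. *)
  have Wu := spd_unit (W_spd ZQf).
  rewrite (W_inv Zf QQ) -mulmxA invmx_mul ?unitmx_mul ?unitmx_tr ?Wu //.
  rewrite invmx_mul ?unitmx_tr // -mulmxA.
  have Qi : invmx Q = Q^T by rewrite -[LHS]mul1mx -QQ mulmxK.
  have Qti : invmx Q^T = Q by rewrite -[LHS]mul1mx -QQ' mulmxK ?unitmx_tr.
  by rewrite Qi Qti !mulmxA -(mulmxA _ Q^T) QQ mulmx1.
Qed.

End Quotient.
End Fields.

(** * The two Hessians at a critical point *)

Section Hessians.
Context {R : realType} {p r : nat} {W : 'M[R]_(p, r) -> 'M[R]_r}.
Hypothesis W_spd : forall Y, full_col_rank p r Y -> spd (W Y).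
Hypothesis W_C1 : Ck 1 (full_col_rank p r) W.
Hypothesis W_inv : forall (Y : 'M[R]_(p, r)) (Q : 'M[R]_r),
  full_col_rank p r Y -> orthonormal_cols Q -> W Y = Q *m W (Y *m Q) *m Q^T.
Context {f : 'M[R]_p -> R} (fC : C2_sym f).
Let h (Z : 'M[R]_(p, r)) := f (Z *m Z^T).
Let grad_f := rgrad (embedded p r) f.
Let grad_h := rgrad (quotient W) h.

Lemma rgrad_embedded_gram Z : full_col_rank p r Z ->
  grad_f (Z *m Z^T) *m Z = nab f (Z *m Z^T) *m Z.
Proof.
move=> Zf; have Zr := psd_rank_gram Zf.
have [U UU UX] := psd_rank_basis Zr.
rewrite /grad_f (rgrad_embedded fC Zr UU UX) /ptan mulmxBl.
have UZ := (col_basis_gram U Zf).1 UX.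
have [ZE _] := col_basisE Zf (conj UU UZ).
have -> : (1%:M - U *m U^T) *m nab f (Z *m Z^T) *m (1%:M - U *m U^T) *m Z = 0.
  have NZ : (1%:M - U *m U^T) *m Z = 0 by rewrite mulmxBl mul1mx -mulmxA ZE subrr.
  by rewrite -mulmxA NZ mulmx0.
by rewrite subr0.
Qed.

Lemma grad_h_gram Z : full_col_rank p r Z ->
  grad_h Z = 2 *: (grad_f (Z *m Z^T) *m Z *m invmx (W Z)).
Proof.
move=> Zf; rewrite rgrad_embedded_gram //.
exact: (rgrad_quotient W_spd fC Zf).
Qed.

Lemma is_derive_frob (M : 'M[R]_p -> 'M[R]_p) x v D (B : 'M[R]_p) :
  is_derive x v M D -> is_derive x v (fun z => frob (M z) B) (frob D B).
Proof.
move=> Md; have Bd := is_derive_cst B x v.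
have /is_derive_mxP MBd := is_derive_mulmx (is_derive_trmx Md) Bd.
apply: (is_derive_ext (f := \sum_(i < p) (fun z => ((M z)^T *m B) i i)) _ _
  (is_derive_sum (fun i => MBd i i))).
  by move=> z; rewrite fct_sumE.
by apply: eq_bigr => i _; rewrite mulmx0 addr0.
Qed.

Lemma nab_differentiable X : differentiable (nab f) X.
Proof. by have [d _] := nab_C1 fC; exact: d. Qed.

Lemma hessian_swap X xi eta :
  frob ('D_xi (nab f) X) eta = frob ('D_eta (nab f) X) xi.
Proof.
have E u v : frob ('D_u (nab f) X) v = 'D_u ('D_v f) X.
  have -> : 'D_v f = (fun Z => frob (nab f Z) v).
    by apply/funext => Z; rewrite derive_frob //; exact: C2_differentiable.
  have nd : is_derive X u (nab f) ('D_u (nab f) X).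
    exact/derivableP/diff_derivable/nab_differentiable.
  by have [_ ->] := is_derive_frob v nd.
have [f2 _] := fC.
have S := @derive_swap R _ f X eta xi f2.
apply: etrans (E xi eta) _.
apply: etrans _ (esym (E eta xi)).
exact: S.
Qed.

Section Point.
Context {Y : 'M[R]_(p, r)} (Yf : full_col_rank p r Y).
Let X := Y *m Y^T.
Let Xr : psd_rank p r X := psd_rank_gram Yf.
Hypothesis crit : grad_h Y = 0.

Lemma critical_nab : nab f X *m Y = 0.
Proof.
have Wu := spd_unit (W_spd Yf).
move: crit; rewrite grad_h_gram // rgrad_embedded_gram // => /eqP.
rewrite scaler_eq0 pnatr_eq0 /= => /eqP e.
by rewrite -[LHS](mulmxKV Wu) [X in X *m _]e mul0mx.
Qed.

(** [nab f X] itself may be nonzero: only its blocks meeting the range of [X] vanish, and [ptan]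
    keeps exactly those. *)
Lemma critical_embedded : grad_f X = 0.
Proof.
have [U UU UX] := psd_rank_basis Xr; have [Xi XiX] := range_pinv Xr UU UX.
have [[Xs _] _] := Xr.
rewrite /grad_f (rgrad_embedded fC Xr UU UX) /ptan.
have Gs : sym (nab f X) by exact: nab_sym.
have GP : nab f X *m (U *m U^T) = 0.
  have -> : U *m U^T = X *m Xi^T by rewrite -{1}Xs -trmx_mul XiX trmx_mul trmxK.
  by rewrite /X -mulmxA [nab f _ *m _]mulmxA critical_nab mul0mx.
have PG : U *m U^T *m nab f X = 0.
  by move/(congr1 trmx): GP; rewrite trmx_mul [(U *m _)^T]trmx_mul trmxK Gs trmx0.
by rewrite mulmxBl mul1mx PG subr0 mulmxBr mulmx1 GP subr0 subrr.
Qed.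

(* Differentiate [grad_f (c c^T) c = nab f (c c^T) c] along [c t = Y + t eta]. *)
Lemma hess_embedded_key eta a :
  is_tderive (psd_rank p r) X (Lmap Y eta) grad_f a ->
  [/\ sym a, sym ('D_(Lmap Y eta) (nab f) X) &
      a *m Y = 'D_(Lmap Y eta) (nab f) X *m Y + nab f X *m eta].
Proof.
move=> aT; pose c t := Y + t *: eta; have cc := curve_line eta Yf.
have Cc := gram_curve cc.
have ad := aT _ Cc; have [cf c0 cd] := cc; have [Cr C0 Cd] := Cc.
have nd := is_derive_comp Cd (nab_differentiable _).
have l := is_derive_mulmx ad cd; have r' := is_derive_mulmx nd cd.
rewrite /= C0 in nd; rewrite /= C0 c0 in r'.
(* The term [grad_f X *m eta] of the product rule vanishes; its counterpart [nab f X *m eta] need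
   not. *)
rewrite /= C0 c0 critical_embedded mul0mx addr0 in l.
split.
- apply: (is_derive_unique (is_derive_trmx ad)).
  apply: (near_eq_is_derive _ ad); near=> t.
  have Ctr : psd_rank p r (c t *m (c t)^T) by near: t.
  have [_ gT _] := rgrad_embedded_field (r := r) fC.
  have [U UU UX] := psd_rank_basis Ctr.
  by have [] := (tangent_psd_rankP Ctr UU UX _).1 (gT _ Ctr).
- apply: (is_derive_unique (is_derive_trmx nd)); apply: is_derive_ext nd => // t.
  by rewrite /= (nab_gram_sym fC).
- apply: (is_derive_unique l); apply: (near_eq_is_derive _ r').
  near=> t; rewrite /= rgrad_embedded_gram //; near: t; exact: cf.
Unshelve. all: by end_near. Qed.

(** The first form is the one matched with the quotient Hessian. The second splits it into the
    Euclidean Hessian and a curvature term, each symmetric in [eta] and [eta']. *)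
Lemma hess_embedded_pairing eta eta' a :
  is_tderive (psd_rank p r) X (Lmap Y eta) grad_f a ->
  frob a (Lmap Y eta') = 2 * frob (a *m Y) eta' /\
  frob a (Lmap Y eta') = frob ('D_(Lmap Y eta) (nab f) X) (Lmap Y eta') +
    2 * frob (nab f X *m eta) eta'.
Proof.
move=> /hess_embedded_key[as_ Hs aY]; rewrite !frob_Lmap //; split=> //.
by rewrite aY (ipD (@frob_inner_product R p r)) mulrDr.
Qed.

(** Self-adjointness of both Hessian operators rests on this: mixed derivatives commute in the first
    term, and [nab f X] is symmetric in the second. *)
Lemma hess_embedded_sym eta eta' a b :
  is_tderive (psd_rank p r) X (Lmap Y eta) grad_f a ->
  is_tderive (psd_rank p r) X (Lmap Y eta') grad_f b ->
  frob a (Lmap Y eta') = frob b (Lmap Y eta).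
Proof.
move=> /(hess_embedded_pairing eta')[_ e1] /(hess_embedded_pairing eta)[_ e2].
apply: etrans e1 _; apply: etrans _ (esym e2); congr (_ + 2 * _).
  exact: hessian_swap.
rewrite [RHS]frobC /frob trmx_mul (nab_gram_sym fC) !mulmxA //.
Qed.

Lemma vsp_embedded (w : 'M[R]_p) : vsp (embedded p r) X w -> w = 0.
Proof.
move=> [c [cM c0 cd]]; have c0d := is_derive_cst X (0 : R) 1.
apply: (is_derive_unique cd); apply: (near_eq_is_derive _ c0d).
by near=> t; have [a /= -> ->] : orbit_of (embedded p r) X (c t) by near: t.
Unshelve. all: by end_near. Qed.

Lemma rhess_embedded nabla_e eta a : levi_civita (embedded p r) nabla_e ->
  is_tderive (psd_rank p r) X (Lmap Y eta) grad_f a ->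
  rhess_op (embedded p r) nabla_e f X (Lmap Y eta) = a.
Proof.
move=> lc aT; have [U UU UX] := psd_rank_basis Xr.
have LT := tangent_Lmap eta Yf.
have [Ls _] := (tangent_psd_rankP Xr UU UX _).1 LT.
(* The gradient of the linear function [frob (Lmap Y eta)] is a field with value [Lmap Y eta] at
   [X], since that vector is already tangent. *)
have [vC vE] := frob_C2_sym Ls.
have VX : rgrad (embedded p r) (frob (Lmap Y eta)) X = Lmap Y eta.
  by rewrite (rgrad_embedded vC Xr UU UX) vE (ptan_id Xr UU UX).
have fld := rgrad_embedded_field (r := r) fC.
have fldv := rgrad_embedded_field (r := r) vC.
have := nabla_at_zero lc Xr fldv fld critical_embedded; rewrite VX => /(_ _ aT).
by move=> /vsp_embedded/subr0_eq.
Qed.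

(** [Z Z^T] is constant on an orbit, so its differential [Lmap Y] kills vertical velocities. *)
Lemma vsp_quotient eta : vsp (quotient W) Y eta ->
  exists2 A : 'M[R]_r, A^T = - A & eta = Y *m A.
Proof.
move=> [c [cM c0 cd]]; apply: Lmap_ker => //.
have Xd := is_derive_cst X (0 : R) 1.
have := is_derive_mulmx cd (is_derive_trmx cd); rewrite c0 addrC => ccd.
apply: (is_derive_unique ccd); apply: (near_eq_is_derive _ Xd).
near=> t; have [a [Q QQ ->] ->] : orbit_of (quotient W) Y (c t) by near: t.
by rewrite trmx_mul mulmxA -(mulmxA Y) (mulmx1C QQ) mulmx1.
Unshelve. all: by end_near. Qed.

(** The trace of a skew matrix times a symmetric one is zero. Hence the vertical vector left
    undetermined by the torsion axiom does not affect the Hessian form. *)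
Lemma met_vertical (A : 'M[R]_r) theta : A^T = - A -> horizontal W Y theta ->
  met (quotient W) Y (Y *m A) theta = 0.
Proof.
move=> As /(horizontalP W _ Yf) Ss /=.
have -> : \tr (W Y *m (Y *m A)^T *m theta) = \tr (A^T *m (Y^T *m theta *m W Y)).
  by rewrite trmx_mul -!mulmxA mxtrace_mulC !mulmxA.
move: Ss; move: (Y^T *m theta *m W Y) => S Ss.
have : \tr (A^T *m S) = - \tr (A^T *m S).
  rewrite -{1}mxtrace_tr trmx_mul trmxK Ss mxtrace_mulC.
  by rewrite As mulNmx raddfN /= opprK.
by move=> ?; lra.
Qed.

(* [theta] is the value at [Y] of the gradient of the function induced by [frob v],
   where [v] is a symmetric matrix solving [2 v Y = theta (W Y)]. *)
Lemma horizontal_field theta : horizontal W Y theta ->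
  exists V, vector_field (quotient W) V /\ V Y = theta.
Proof.
move=> /(horizontalP W _ Yf) Ss; have Wu := spd_unit (W_spd Yf).
pose K := invmx (Y^T *m Y) *m Y^T.
have [N NE] : exists N, N = theta *m W Y by exists (theta *m W Y).
have KY : K *m Y = 1%:M by rewrite /K -mulmxA mulVmx ?rank_gram_unit.
clearbody K.
have YNs : sym (Y^T *m N) by rewrite NE mulmxA.
have YN : N^T *m Y = Y^T *m N by rewrite -[RHS]YNs trmx_mul trmxK.
(* As [K Y = 1], the first term alone would give [v Y = N / 2]. The second makes [v] symmetric, and
   the third cancels its contribution to [v Y] because [N^T Y = Y^T N]. *)
pose v := 2^-1 *: (N *m K + (N *m K)^T - K^T *m (Y^T *m N) *m K).
have vs : v^T = v.
  have := sym_congr K^T YNs; rewrite /v trmxK.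
  move: (N *m K) (K^T *m _ *m K) => M S Ks.
  rewrite linearZ /=; congr (_ *: _).
  by rewrite raddfB /= Ks raddfD /= trmxK [M^T + M]addrC.
have vY : v *m Y = 2^-1 *: N.
  rewrite /v -scalemxAl mulmxBl mulmxDl -(mulmxA N) KY mulmx1.
  rewrite -(mulmxA _ K) KY mulmx1 trmx_mul -mulmxA YN.
  by rewrite addrK.
have [vC vE] := frob_C2_sym vs.
exists (rgrad (quotient W) (fun Z => frob v (Z *m Z^T))); split.
  exact: (rgrad_quotient_field W_spd W_C1 W_inv vC).
rewrite (rgrad_quotient W_spd vC Yf) /quotient_grad vE vY NE.
by rewrite -scalemxAl scalerA mulfV ?pnatr_eq0 // scale1r mulmxK.
Qed.

(* Differentiate [grad_h c (W c) = 2 grad_f (c c^T) c] along [c t = Y + t theta]. *)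
Lemma rhess_quotient nabla_q theta theta' a :
  levi_civita (quotient W) nabla_q ->
  horizontal W Y theta -> horizontal W Y theta' ->
  is_tderive (psd_rank p r) X (Lmap Y theta) grad_f a ->
  rhess (quotient W) nabla_q h Y theta theta' = 2 * frob (a *m Y) theta'.
Proof.
move=> lc tH t'H aT; have Wp := W_spd Yf; have [Ws _] := Wp.
have [V [Vf VY]] := horizontal_field tH.
have fld : vector_field (quotient W) grad_h.
  exact: (rgrad_quotient_field W_spd W_C1 W_inv fC).
have [gC _ _] := fld; have [D [_ DT]] := C1_on_tderive gC Yf.
have cc := curve_line theta Yf; have [cf c0 cd] := cc.
have Cc := gram_curve cc; have [_ C0 _] := Cc.
have Wd : differentiable W (Y + (0 : R) *: theta).
  by rewrite c0; have [d _] := W_C1; exact: d.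
have aW : D theta *m W Y = 2 *: (a *m Y).
  have l := is_derive_mulmx (DT theta _ cc) (is_derive_comp cd Wd).
  have r' := is_deriveZ 2 (is_derive_mulmx (aT _ Cc) cd).
  (* Both gradients vanish at the point: this removes the term with the derivative of [W] on one
     side and [grad_f X *m theta] on the other. *)
  rewrite /= c0 crit mul0mx addr0 in l.
  rewrite /= C0 c0 critical_embedded mul0mx addr0 in r'.
  apply: (is_derive_unique l); apply: (near_eq_is_derive _ r').
  near=> t; have ctf : full_col_rank p r (Y + t *: theta) by near: t.
  rewrite /= (grad_h_gram ctf) -scalemxAl mulmxKV //.
  exact/spd_unit/W_spd.
have := nabla_at_zero lc Yf Vf fld crit; rewrite VY => /(_ _ (DT theta)).
move=> /vsp_quotient[A As e].
have {}e : rhess_op (quotient W) nabla_q h Y theta = D theta + Y *m A.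
  by rewrite -e addrC subrK.
rewrite /rhess e /=.
have -> : (D theta + Y *m A)^T = (D theta)^T + (Y *m A)^T by rewrite raddfD.
rewrite mulmxDr mulmxDl raddfD /=.
have := met_vertical As t'H => /= ->; rewrite addr0.
by rewrite -(ipZ (@frob_inner_product R p r)) -aW /frob trmx_mul Ws.
Unshelve. all: by end_near. Qed.

End Point.
End Hessians.

(** * The quotient metric compared with the Frobenius norm through [Lmap Y] *)

Section Comparison.
Context {R : realType} {p r : nat} {W : 'M[R]_(p, r) -> 'M[R]_r}.
Hypothesis W_spd : forall Y, full_col_rank p r Y -> spd (W Y).

Lemma mpinv_full (Y : 'M[R]_(p, r)) : \rank Y = r ->
  mpinv Y = invmx (Y^T *m Y) *m Y^T.
Proof.
move=> rY; have Gu := rank_gram_unit rY.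
have Gs : (invmx (Y^T *m Y))^T = invmx (Y^T *m Y).
  by rewrite trmx_inv trmx_mul trmxK.
have KY : invmx (Y^T *m Y) *m Y^T *m Y = 1%:M by rewrite -mulmxA mulVmx.
apply: xget_unique.
  split; [by rewrite -mulmxA KY mulmx1|by rewrite KY mul1mx| |by rewrite KY trmx1].
  by rewrite !trmx_mul trmxK Gs mulmxA.
move=> B [YBY _ YBs _].
(* These are the normal equations, whose solution is unique by full rank. *)
have : Y^T *m Y *m B = Y^T.
  by rewrite -mulmxA -YBs -[in RHS]YBY [RHS]trmx_mul.
by move=> e; rewrite -[B](mulKmx Gu) e.
Qed.

Context {Y : 'M[R]_(p, r)} (Yf : full_col_rank p r Y).
Context {U : 'M[R]_(p, r)} (UU : orthonormal_cols U) (UY : (U^T :=: Y^T)%MS).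
Hypothesis r_gt0 : (0 < r)%N.
Let P := U^T *m Y.
Let A := P *m invmx (W Y) *m P^T.
Let g := met (quotient W) Y.

Lemma metE eta theta : g eta theta = frob (eta *m W Y) theta.
Proof. by have [Ws _] := W_spd Yf; rewrite /g /= /frob trmx_mul Ws. Qed.

Lemma met_inner_product : inner_product g.
Proof.
split=> [u v|k u v w|u u0].
- rewrite !metE [RHS]frobC /frob trmx_mul; have [-> _] := W_spd Yf.
  by rewrite mulmxA [RHS]mxtrace_mulC mulmxA mxtrace_mulC !mulmxA.
- by rewrite !metE mulmxDl -scalemxAl frob_linear.
- have [C Cu WE] := spd_factor (W_spd Yf).
  have -> : g u u = frob (u *m C) (u *m C).
    by rewrite metE WE /frob !trmx_mul trmxK -!mulmxA mxtrace_mulC -!mulmxA.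
  apply: (ip_gt0 (frob_inner_product p r)); apply: contraNneq u0 => uC.
  by rewrite -(mulmxK Cu u) uC mul0mx.
Qed.

Lemma weighted_gram_spd : spd A.
Proof.
have [C Cu WE] := spd_factor (W_spd Yf).
have [_ Pu] := col_basisE Yf (conj UU UY).
rewrite -/P in Pu; rewrite /A; move: P Pu => Q Qu.
have -> : Q *m invmx (W Y) *m Q^T = (invmx C *m Q^T)^T *m (invmx C *m Q^T).
  rewrite WE invmx_mul ?unitmx_tr // trmx_mul trmxK trmx_inv.
  by rewrite !mulmxA.
apply: full_gram_spd; apply/eqP; rewrite -/(row_full _) row_full_unit.
by rewrite unitmx_mul unitmx_inv Cu unitmx_tr.
Qed.

Lemma sigma_gt0 : 0 < sigma r A.
Proof.
have [Q [l [QQ AE lp]]] := spd_spectral weighted_gram_spd.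
by have [] := sigma_spectral r_gt0 QQ AE lp.
Qed.

(** As [Y = U P] with [U] orthonormal, [theta Y^T] and [theta P^T] have the same norm; the weight
    [W] becomes [A^-1] when [theta] is expressed through [theta P^T]. *)
Lemma Lmap_sigma_bound theta : theta \in hvspace Y (W Y) ->
  2 * sigma r A * g theta theta <= frob (Lmap Y theta) (Lmap Y theta)
    <= 4 * sigma 1 A * g theta theta.
Proof.
move=> tH; have Wp := W_spd Yf; have Wu := spd_unit Wp.
have [YE Pu] := col_basisE Yf (conj UU UY); rewrite -/P in YE Pu.
have := sigma_inverse_bounds (theta *m P^T) r_gt0 weighted_gram_spd.
have := Lmap_bound Wp tH; rewrite /A; move: P YE Pu => Q YQ Qu.
have -> : frob (theta *m Q^T) (theta *m Q^T) = frob (theta *m Y^T) (theta *m Y^T).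
  rewrite -YQ [(U *m Q)^T]trmx_mul mulmxA; move: (theta *m Q^T) => V.
  rewrite /frob trmx_mul trmxK -mulmxA [RHS]mxtrace_mulC.
  by rewrite -!mulmxA UU mulmx1.
have -> : \tr (theta *m Q^T *m invmx (Q *m invmx (W Y) *m Q^T) *m
    (theta *m Q^T)^T) = g theta theta.
  rewrite -(mulmxA Q) !invmx_mul ?unitmx_mul ?unitmx_inv ?unitmx_tr ?Wu ?Qu //.
  rewrite trmx_mul trmxK invmxK; have [Ws _] := Wp.
  have e : theta *m Q^T *m (invmx Q^T *m W Y *m invmx Q) *m (Q *m theta^T) =
      theta *m W Y *m theta^T.
    by rewrite !mulmxA mulmxK ?unitmx_tr // mulmxKV.
  by rewrite e metE frobC /frob mxtrace_mulC.
move=> /andP[b1 b2] /andP[s1 s2].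
apply/andP; split.
  by apply: le_trans b1; rewrite -mulrA ler_pM2l.
by apply: le_trans b2 _; rewrite -mulrA ler_pM2l.
Qed.

End Comparison.

(** * Assembly of the gradient formulas, the Hessian identity and the eigenvalue bounds *)

Theorem theorem3 (R : realType) (p r : nat) (hr : (1 <= r <= p)%N)
    (f : 'M[R]_p -> R) (f_C2 : Ck 2 setT f) (f_tr : forall X, f X = f X^T)
    (W : 'M[R]_(p, r) -> 'M[R]_r)
    (W_spd : forall Y, full_col_rank p r Y -> spd (W Y))
    (W_smooth : forall k, Ck k (full_col_rank p r) W)
    (W_inv : forall (Y : 'M[R]_(p, r)) (O : 'M[R]_r),
        full_col_rank p r Y -> orthonormal_cols O ->
        W Y = O *m W (Y *m O) *m O^T)
    (nabla_e : 'M[R]_p -> 'M[R]_p -> ('M[R]_p -> 'M[R]_p) -> 'M[R]_p)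
    (nabla_e_lc : levi_civita (embedded p r) nabla_e)
    (nabla_q : 'M[R]_(p, r) -> 'M[R]_(p, r) ->
        ('M[R]_(p, r) -> 'M[R]_(p, r)) -> 'M[R]_(p, r))
    (nabla_q_lc : levi_civita (quotient W) nabla_q)
    (Y : 'M[R]_(p, r)) (Y_full : full_col_rank p r Y)
    (X : 'M[R]_p) (X_def : X = Y *m Y^T)
    (U : 'M[R]_(p, r)) (U_St : orthonormal_cols U) (U_span : (U^T :=: X^T)%MS)
    (P : 'M[R]_r) (P_def : P = U^T *m Y) :
  let h := fun Z : 'M[R]_(p, r) => f (Z *m Z^T) in
  let grad_f := rgrad (embedded p r) f in
  let grad_h := rgrad (quotient W) h in
  let G := grad_h Y *m W Y *m mpinv Y in
  let A := P *m invmx (W Y) *m P^T in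
  let d := (p * r - (r ^ 2 - r) %/ 2)%N in
  [/\ grad_f X = 2^-1 *: (G + G^T *m (1%:M - Y *m mpinv Y)),
      grad_h Y = 2 *: (grad_f X *m Y *m invmx (W Y)) &
      grad_h Y = 0 ->
        (forall theta, horizontal W Y theta ->
           rhess (quotient W) nabla_q h Y theta theta =
           rhess (embedded p r) nabla_e f X (Lmap Y theta) (Lmap Y theta)) /\
        exists lambda_h lambda_f : seq R,
          [/\ eigenvalues_on (horizontal W Y)
                (rhess_op (quotient W) nabla_q h Y) lambda_h,
              eigenvalues_on (tangent_space (psd_rank p r) X)
                (rhess_op (embedded p r) nabla_e f X) lambda_f,
              size lambda_h = d, size lambda_f = d &
              forall i, (i < d)%N ->
                sandwiched lambda_h`_i
                  (2 * sigma r A * lambda_f`_i) (4 * sigma 1 A * lambda_f`_i)]].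
Proof.
have fC : C2_sym f by [].
have W_C1 := W_smooth 1%N.
subst X P => h grad_f grad_h G A d; set X := Y *m Y^T in U_span grad_f *.
have r_gt0 : (0 < r)%N by case/andP: hr.
have Xs : X^T = X by rewrite trmx_mul trmxK.
have UX : (U^T :=: X)%MS by rewrite Xs in U_span.
have UY := (col_basis_gram U Y_full).1 UX.
have Xr : psd_rank p r X := psd_rank_gram Y_full.
have Wu := spd_unit (W_spd Y Y_full).
have gfE := rgrad_embedded fC Xr U_St UX.
have ghE : grad_h Y = quotient_grad (W := W) (f := f) Y.
  exact: (rgrad_quotient W_spd fC Y_full).
have YK : Y *m mpinv Y = U *m U^T.
  by rewrite (mpinv_full Y_full) mulmxA (proj_eq Y_full U_St) ?UY.
split.
(* With [Q = U U^T] and [N = nab f X], the right side becomes [N Q + Q N (1 - Q)], which is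
   [N - (1 - Q) N (1 - Q)]. *)
- have GE : G = 2 *: (nab f X *m (U *m U^T)).
    by rewrite /G ghE /quotient_grad -!scalemxAl mulmxKV // -mulmxA YK.
  have Gs : sym (nab f X) by exact: nab_sym.
  have Us : (U *m U^T)^T = U *m U^T by rewrite trmx_mul trmxK.
  rewrite /grad_f gfE GE YK /ptan; move: (U *m U^T) Us => Q Qs.
  rewrite linearZ /= trmx_mul Gs Qs -scalemxAl -scalerDr scalerA mulVf ?pnatr_eq0 //.
  rewrite scale1r; move: (nab f X) => N.
  have -> : (1%:M - Q) *m N *m (1%:M - Q) = N - N *m Q - Q *m N *m (1%:M - Q).
    by rewrite mulmxBl mul1mx mulmxBl [N *m (1%:M - Q)]mulmxBr mulmx1.
  move: (N *m Q) (Q *m N *m _) => B C.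
  by apply/matrixP => i j; rewrite !mxE; ring.
- exact: (grad_h_gram W_spd fC Y_full).
move=> crit.
have fld_f := rgrad_embedded_field (r := r) fC.
have fld_h : vector_field (quotient W) grad_h.
  exact: (rgrad_quotient_field W_spd W_C1 W_inv fC).
have [gC _ _] := fld_f; have [D [_ DT]] := C1_on_tderive gC Xr.
(* Every tangent vector at [X] has the form [Lmap Y eta], so [D] computes the embedded Hessian
   operator on the whole tangent space. *)
have opE eta : rhess_op (embedded p r) nabla_e f X (Lmap Y eta) = D (Lmap Y eta).
  exact: (rhess_embedded W_spd fC Y_full crit nabla_e_lc (DT _)).
have hessE theta theta' : horizontal W Y theta -> horizontal W Y theta' ->
    rhess (quotient W) nabla_q h Y theta theta' =
    frob (D (Lmap Y theta)) (Lmap Y theta').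
  move=> tH t'H.
  apply: etrans (rhess_quotient W_spd W_C1 W_inv fC Y_full crit nabla_q_lc tH t'H
    (DT (Lmap Y theta))) _.
  by have [-> _] := hess_embedded_pairing W_spd fC Y_full crit theta'
    (DT (Lmap Y theta)).
split.
  move=> theta tH; apply: etrans (hessE _ _ tH tH) _.
  by rewrite /rhess opE.
pose V := hvspace Y (W Y).
have VP theta : theta \in V <-> horizontal W Y theta.
  split=> [/mem_hvspace Ss|/(horizontalP W _ Y_full) Ss].
    exact/(horizontalP W _ Y_full).
  exact/mem_hvspace.
pose L : 'Hom('M[R]_(p, r), 'M[R]_p) := linfun (Lmap Y).
have LE : L =1 Lmap Y by apply: linfunE; exact: Lmap_linear.
have TP xi : xi \in (L @: V)%VS <-> tangent_space (psd_rank p r) X xi.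
  split=> [/memv_imgP[theta _ ->]|/(tangent_LmapP _ Y_full)[eta ->]].
    by rewrite LE; exact: tangent_Lmap.
  have [theta tV <-] := Lmap_horizontal_onto eta Y_full (W_spd Y Y_full).
  by rewrite -LE memv_img.
have ipq := met_inner_product W_spd Y_full.
have ipe := frob_inner_product (R := R) p p.
have T1 : self_adjoint_on (met (quotient W) Y) V (rhess_op (quotient W) nabla_q h Y).
  split=> [k u v /VP uH /VP vH|u /VP uH|u v /VP uH /VP vH].
  - exact: (nabla_linear nabla_q_lc).
  - by apply/VP; exact: (nabla_hsp nabla_q_lc).
  - apply: etrans (hessE _ _ uH vH) _; apply/esym.
    apply: etrans (ipC ipq _ _) _; apply: etrans (hessE _ _ vH uH) _.
    exact: (hess_embedded_sym W_spd fC Y_full crit (DT _) (DT _)).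
have T2 : self_adjoint_on (@frob R p p) (L @: V)%VS
    (rhess_op (embedded p r) nabla_e f X).
  split=> [k u v /TP uT /TP vT|u /TP uT|_ _ /memv_imgP[u _ ->] /memv_imgP[v _ ->]].
  - exact: (nabla_linear nabla_e_lc).
  - by apply/TP; exact: (nabla_hsp nabla_e_lc).
  - rewrite !LE !opE [RHS]frobC.
    exact: (hess_embedded_sym W_spd fC Y_full crit (DT _) (DT _)).
have [s [so sV sT ss]] := spectral ipq T1.
have [t [to tV tT ts]] := spectral ipe T2.
have LB : {in V, forall x, 2 * sigma r A * met (quotient W) Y x x
    <= frob (L x) (L x) <= 4 * sigma 1 A * met (quotient W) Y x x}.
  by move=> x xV; rewrite LE; exact: (Lmap_sigma_bound W_spd Y_full U_St UY r_gt0).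
have s0 : 0 < 2 * sigma r A.
  by rewrite mulr_gt0 //; exact: (sigma_gt0 W_spd Y_full U_St UY r_gt0).
have TSL : {in V, forall x, met (quotient W) Y (rhess_op (quotient W) nabla_q h Y x) x
    = frob (rhess_op (embedded p r) nabla_e f X (L x)) (L x)}.
  by move=> x /VP xH; rewrite LE opE; exact: hessE.
have dV : \dim V = d.
  have := dim_hvspace Y_full Wu; rewrite -/V bin2 /d => <-.
  have -> : ((r ^ 2 - r) %/ 2)%N = (r * r.-1)./2.
    by rewrite -divn2 -subn1 mulnBr muln1 -mulnn.
  by rewrite addnK.
have dL : \dim (L @: V)%VS = \dim V.
  exact: (bounded_dim ipq ipe (L := L) (V := V) erefl s0 LB).
exists [seq met (quotient W) Y (rhess_op (quotient W) nabla_q h Y u) u | u <- s].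
exists [seq frob (rhess_op (embedded p r) nabla_e f X u) u | u <- t].
have hE : horizontal W Y = (fun x => x \in V).
  by apply/seteqP; split=> x /VP.
have tE : tangent_space (psd_rank p r) X = (fun x => x \in (L @: V)%VS).
  by apply/seteqP; split=> x /TP.
split.
- by rewrite hE; exact: (spectral_eigenvalues ipq T1).
- by rewrite tE; exact: (spectral_eigenvalues ipe T2).
- by rewrite size_map (orthonormal_dim ipq so sV).
- by rewrite size_map (orthonormal_dim ipe to tV) dL.
- move=> i id_.
  apply: (sandwiched_eigenvalues ipq ipe T1 T2 erefl s0 LB TSL so sV sT to tV tT ss ts).
  by rewrite dV.
Qed.
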